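(* Let $f$ be analytic on the unit disk $\mathbb{D}=\{z\in\mathbb{C}:|z|<1\}$ with $\operatorname{Diam} f(\mathbb{D})\le 2$. Then $|f'(0)|\le 1$. Moreover, $|f'(0)|=1$ if and only if $f(z)=a+cz$ for all $z\in\mathbb{D}$, for some constants $a,c\in\mathbb{C}$ with $|c|=1$.
   Context: For a set $E\subset\mathbb{C}$, $\operatorname{Diam}E=\sup_{z,w\in E}|z-w|$. *)

(* Defs.v *)
From mathcomp Require Import all_boot all_order all_algebra.
From mathcomp Require Import all_classical all_reals all_analysis.
From mathcomp Require Import complex.
Import Order.TTheory GRing.Theory Num.Theory.
Import numFieldNormedType.Exports.
Set Implicit Arguments.
Unset Strict Implicit.
Unset Printing Implicit Defensive.
Local Open Scope ring_scope.
Local Open Scope classical_set_scope.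

(* The complex plane, viewed as a normed module over itself (regular algebra),
   so that [derivable f z 1] is complex differentiability. *)
Definition Cplx (R : realType) := (R[i])^o.

Definition unit_disk (R : realType) : set (Cplx R) := [set z | `|z| < 1].
Arguments unit_disk R : clear implicits.

Definition analytic_on_disk (R : realType) (f : Cplx R -> Cplx R) : Prop :=
  forall z : Cplx R, z \in unit_disk R -> derivable f z 1.

Definition Diam_le (R : realType) (E : set (Cplx R)) (d : Cplx R) : Prop :=
  forall z w, E z -> E w -> `|z - w| <= d.

(* Main.v *)
Require Import Defs.
From mathcomp Require Import all_boot all_order all_algebra.
From mathcomp Require Import all_classical all_reals all_analysis.
From mathcomp Require Import complex ring lra.
Import Order.TTheory GRing.Theory Num.Theory.
Import numFieldNormedType.Exports.
Set Implicit Arguments.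
Unset Strict Implicit.
Unset Printing Implicit Defensive.
Local Open Scope ring_scope.
Local Open Scope classical_set_scope.

(** The even part of [f] is irrelevant for the derivative at [0]: Schwarz's lemma
    applied to [(f(z) - f(-z)) / 2] gives [|f'(0)| <= 1], and equality forces
    [f(z) - f(-z) = 2 c z] with [c = f'(0)].  Then [f(z) = c (z + H(z))] with [H]
    even.  For [|w| = 1], expanding [|f(z) - f(-w z)| <= 2] around the extremal
    pair [(z, -z)] gives [Re ((H(z) - H(w z)) / z) <= 1 - Re w + (1 - r^2) / r^2]
    on [|z| = r].  The maximum principle removes the error term, and since this
    quotient is odd in [z], [|Re ((H(z) - H(w z)) / z)| <= 1 - Re w].  The right
    side is of second order as [w -> 1], so [H'] is real, hence constant, and
    [H'(0) = 0] makes [H] constant.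

    The maximum principle comes from the mean value property.  With
    [G(s + i t) = q(exp(s + i t))], Goursat's theorem on the rectangle
    [[s1, s2] x [0, 2 pi]] and periodicity in [t] show that the circle means of
    [q] do not depend on the radius; only continuity of [q] at [0] is needed, so
    difference quotients at [0] are covered without removing singularities.
    Line integrals are increments of primitives, bounded by the mean value theorem. *)

(** * Modulus and topology of the complex plane *)

Section ComplexModulus.
Variable R : realType.
Local Notation C := (Cplx R).
Local Notation ReC := (@complex.Re R).
Local Notation ImC := (@complex.Im R).
Implicit Types z w : C.

(** The norm of [R[i]] is itself an element of [R[i]]; its real part is a modulus in the ordered
    field [R], where all estimates below take place. *)
Definition cmod z : R := ReC `|z|.

Lemma norm_cmod z : `|z| = (cmod z)%:C%C :> R[i].
Proof. by rewrite /cmod normc_def. Qed.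

Lemma cmodE z : cmod z = Num.sqrt (ReC z ^+ 2 + ImC z ^+ 2).
Proof. by rewrite /cmod normc_def. Qed.

Lemma cmod_ge0 z : 0 <= cmod z. Proof. by rewrite cmodE sqrtr_ge0. Qed.

Lemma sqr_cmod z : cmod z ^+ 2 = ReC z ^+ 2 + ImC z ^+ 2.
Proof. by rewrite cmodE sqr_sqrtr// addr_ge0// sqr_ge0. Qed.

Lemma cmodM z w : cmod (z * w) = cmod z * cmod w.
Proof. by apply: complexI; rewrite rmorphM/= -!norm_cmod normrM. Qed.

Lemma cmodV z : cmod z^-1 = (cmod z)^-1.
Proof. by apply: complexI; rewrite fmorphV/= -!norm_cmod normfV. Qed.

Lemma cmodN z : cmod (- z) = cmod z.
Proof. by rewrite /cmod normrN. Qed.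

Lemma cmodB z w : cmod (z - w) = cmod (w - z).
Proof. by rewrite /cmod distrC. Qed.

Lemma cmodD z w : cmod (z + w) <= cmod z + cmod w.
Proof. by rewrite -lecR rmorphD/= -!norm_cmod ler_normD. Qed.

Lemma cmod0 : cmod 0 = 0. Proof. by rewrite /cmod normr0. Qed.

Lemma cmod1 : cmod 1 = 1. Proof. by rewrite /cmod normr1. Qed.

Lemma cmod_eq0 z : (cmod z == 0) = (z == 0).
Proof. by rewrite -(inj_eq (@complexI R)) -norm_cmod normr_eq0. Qed.

Lemma cmod_gt0 z : (0 < cmod z) = (z != 0).
Proof. by rewrite lt_def cmod_eq0 cmod_ge0 andbT. Qed.

Lemma cmodJ z : cmod (z^*)%C = cmod z.
Proof. by rewrite /cmod normcJ. Qed.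

Lemma cmod_real (x : R) : cmod x%:C%C = `|x|.
Proof. by rewrite cmodE /= expr0n/= addr0 sqrtr_sqr. Qed.

Lemma Re_le_cmod z : `|ReC z| <= cmod z.
Proof. by rewrite -lecR -norm_cmod normc_ge_Re. Qed.

Lemma Im_le_cmod z : `|ImC z| <= cmod z.
Proof.
rewrite -(@ler_pXn2r _ 2)// ?nnegrE ?cmod_ge0//.
by rewrite sqr_cmod real_normK ?num_real// lerDr sqr_ge0.
Qed.

Lemma cmod_le_ReIm z : cmod z <= `|ReC z| + `|ImC z|.
Proof.
rewrite -(@ler_pXn2r _ 2)// ?nnegrE ?cmod_ge0 ?addr_ge0//.
rewrite sqr_cmod sqrrD !real_normK ?num_real// -addrA lerD2l lerDr.
by rewrite mulrn_wge0// mulr_ge0.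
Qed.

Lemma ReB z w : ReC (z - w) = ReC z - ReC w. Proof. by case: z; case: w. Qed.
Lemma ImB z w : ImC (z - w) = ImC z - ImC w. Proof. by case: z; case: w. Qed.
Lemma ReD z w : ReC (z + w) = ReC z + ReC w. Proof. by case: z; case: w. Qed.
Lemma ReN z : ReC (- z) = - ReC z. Proof. by case: z. Qed.

Lemma mulcJ z : z * (z^*)%C = ((cmod z) ^+ 2)%:C%C.
Proof. by rewrite rmorphXn/= -norm_cmod sqr_normc. Qed.

Lemma unit_diskE z : (z \in unit_disk R) = (cmod z < 1).
Proof.
apply/idP/idP; rewrite inE /unit_disk/= norm_cmod ltcR//.
Qed.

(** Balls of [C] have radii in [R[i]], but a positive element of [R[i]] is real, so real radii
    describe the same neighbourhoods. *)
Lemma nbhs_cmodP z (P : set C) :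
  nbhs z P <-> exists2 d : R, 0 < d & forall w, cmod (w - z) < d -> P w.
Proof.
split=> [/nbhs_ballP[d /= d0 dP]|[d d0 dP]].
  have dR : d = (ReC d)%:C%C by rewrite RRe_real// gtr0_real.
  exists (ReC d); first by rewrite -ltcR -dR.
  move=> w zw; apply: dP; rewrite -ball_normE/= norm_cmod dR ltcR.
  by rewrite cmodB.
apply/nbhs_ballP; exists (d%:C)%C => /=; first by rewrite ltcR.
move=> w; rewrite -ball_normE/= norm_cmod ltcR => zw.
by apply: dP; rewrite cmodB.
Qed.

Lemma continuous_cmodP (q : C -> C) z : {for z, continuous q} <->
  forall e : R, 0 < e -> exists2 d : R, 0 < d &
    forall w, cmod (w - z) < d -> cmod (q w - q z) < e.
Proof.
split=> [qc e e0|qc].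
  have : nbhs (q z) [set w | cmod (w - q z) < e] by apply/nbhs_cmodP; exists e.
  by move=> /qc /nbhs_cmodP.
move=> P /nbhs_cmodP[e e0 eP]; have [d d0 dP] := qc e e0.
by apply/nbhs_cmodP; exists d => // w zw; apply: eP; exact: dP.
Qed.

Lemma continuous_ReC z : {for z, continuous (ReC : C -> R)}.
Proof.
move=> P /nbhs_ballP[e /= e0 eP]; apply/nbhs_cmodP; exists e => // w zw.
apply: eP; rewrite -ball_normE/= distrC -ReB.
exact: le_lt_trans (Re_le_cmod _) zw.
Qed.

Lemma continuous_ImC z : {for z, continuous (ImC : C -> R)}.
Proof.
move=> P /nbhs_ballP[e /= e0 eP]; apply/nbhs_cmodP; exists e => // w zw.
apply: eP; rewrite -ball_normE/= distrC -ImB.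
exact: le_lt_trans (Im_le_cmod _) zw.
Qed.

Lemma continuous_Complex (T : topologicalType) (a b : T -> R) (t : T) :
  {for t, continuous a} -> {for t, continuous b} ->
  {for t, continuous (fun s => (a s +i* b s)%C : C)}.
Proof.
move=> ca cb P /nbhs_cmodP[e e0 eP].
have e2 : 0 < e / 2 by rewrite divr_gt0.
have na : \forall s \near t, ball (a t) (e / 2) (a s).
  exact: (ca _ (nbhsx_ballx (a t) _ e2)).
have nb : \forall s \near t, ball (b t) (e / 2) (b s).
  exact: (cb _ (nbhsx_ballx (b t) _ e2)).
apply: filterS (filterI na nb) => s [/=]; rewrite -!ball_normE/= => sa sb.
apply: eP; apply: le_lt_trans (cmod_le_ReIm _) _ => /=.
by rewrite -[_ + - a t]/(a s - a t) -[_ + - b t]/(b s - b t) distrC [X in _ + X]distrC; lra.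
Qed.

(** First-order expansion with real radii. The increment [h = 0] is included, so that later
    estimates need no case distinction. *)
Lemma derivable_expansion (f : C -> C) z : derivable f z 1 ->
  forall e : R, 0 < e -> exists2 d : R, 0 < d & forall h : C, cmod h < d ->
    cmod (f (z + h) - f z - 'D_1 f z * h) <= e * cmod h.
Proof.
move=> df e e0.
have nD : nbhs ('D_1 f z : C) [set w : C | cmod (w - 'D_1 f z) < e].
  by apply/nbhs_cmodP; exists e.
have /nbhs_cmodP[d d0 dP] := df _ nD.
exists d => // h hd; have [->|h0] := eqVneq h 0.
  by rewrite mulr0 subr0 addr0 subrr cmod0 mulr0 lexx.
have := dP h; rewrite subr0 => /(_ hd h0) /=.
rewrite -[h *: (1 : C)]/(h * 1 : C) mulr1 -[_ *: _]/(h^-1 * (f (h + z) - f z)).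
have -> : f (z + h) - f z - 'D_1 f z * h =
   (h^-1 * (f (h + z) - f z) - 'D_1 f z) * h.
  by rewrite mulrBl mulrAC mulVf// mul1r [h + z]addrC.
by move=> /ltW ?; rewrite cmodM ler_wpM2r// cmod_ge0.
Qed.
End ComplexModulus.

(** * Goursat's theorem on rectangles *)

Section Bisection.
Variable R : realType.
Implicit Types (J : R -> R -> R -> R -> R).

Definition quarter_additive J := forall x y w h,
  J x y w h = J x y (w / 2) (h / 2) + J (x + w / 2) y (w / 2) (h / 2)
    + J x (y + h / 2) (w / 2) (h / 2) + J (x + w / 2) (y + h / 2) (w / 2) (h / 2).

(** If the first three quarters each carry less than a fourth of [J], the triangle inequality leaves
    at least a fourth to the last one. *)
Lemma quarter_large J x y w h : quarter_additive J ->
  exists p : R * R, [/\ (p.1 = x \/ p.1 = x + w / 2),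
    (p.2 = y \/ p.2 = y + h / 2) &
    `|J x y w h| <= 4 * `|J p.1 p.2 (w / 2) (h / 2)|].
Proof.
move=> /(_ x y w h) E.
have := ler_normD (J x y (w / 2) (h / 2) + J (x + w / 2) y (w / 2) (h / 2)
    + J x (y + h / 2) (w / 2) (h / 2)) (J (x + w / 2) (y + h / 2) (w / 2) (h / 2)).
have := ler_normD (J x y (w / 2) (h / 2) + J (x + w / 2) y (w / 2) (h / 2))
    (J x (y + h / 2) (w / 2) (h / 2)).
have := ler_normD (J x y (w / 2) (h / 2)) (J (x + w / 2) y (w / 2) (h / 2)).
rewrite -E => h1 h2 h3.
have [k1|k1] := leP `|J x y w h| (4 * `|J x y (w / 2) (h / 2)|).
  by exists (x, y); split => //; left.
have [k2|k2] := leP `|J x y w h| (4 * `|J (x + w / 2) y (w / 2) (h / 2)|).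
  by exists (x + w / 2, y); split => //; [right|left].
have [k3|k3] := leP `|J x y w h| (4 * `|J x (y + h / 2) (w / 2) (h / 2)|).
  by exists (x, y + h / 2); split => //; [left|right].
by exists (x + w / 2, y + h / 2); split => /=; [right|right|lra].
Qed.

Lemma quarter_sequence J a c w h : quarter_additive J ->
  exists p : nat -> R * R, [/\ p 0 = (a, c),
    forall n, (p n.+1).1 = (p n).1 \/ (p n.+1).1 = (p n).1 + w / 2 ^+ n / 2,
    forall n, (p n.+1).2 = (p n).2 \/ (p n.+1).2 = (p n).2 + h / 2 ^+ n / 2 &
    forall n, `|J a c w h| <= 4 ^+ n * `|J (p n).1 (p n).2 (w / 2 ^+ n) (h / 2 ^+ n)|].
Proof.
move=> Jadd.
have /choice[F FP] : forall s : R * R * nat, exists p : R * R,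
    [/\ (p.1 = s.1.1 \/ p.1 = s.1.1 + w / 2 ^+ s.2 / 2),
    (p.2 = s.1.2 \/ p.2 = s.1.2 + h / 2 ^+ s.2 / 2) &
    `|J s.1.1 s.1.2 (w / 2 ^+ s.2) (h / 2 ^+ s.2)|
      <= 4 * `|J p.1 p.2 (w / 2 ^+ s.2 / 2) (h / 2 ^+ s.2 / 2)|].
  by move=> s; exact: quarter_large.
pose p := fix p n := if n is m.+1 then F (p m, m) else (a, c).
exists p; split => // [n|n|]; first by have [] := FP (p n, n).
  by have [] := FP (p n, n).
elim=> [|n IH]; first by rewrite !expr0 mul1r !divr1.
apply: (le_trans IH); rewrite exprSr -mulrA ler_pM2l ?exprn_gt0//.
have [_ _] := FP (p n, n).
by rewrite /= !(exprSr 2) !invfM !mulrA.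
Qed.

(** The intervals from [p n] to [p n + w / 2 ^+ n] are nested; the supremum of their left endpoints
    lies in all of them. *)
Lemma dyadic_corner_limit (p : nat -> R) (w : R) : 0 <= w ->
  (forall n, p n.+1 = p n \/ p n.+1 = p n + w / 2 ^+ n / 2) ->
  exists x, forall n, p n <= x <= p n + w / 2 ^+ n.
Proof.
move=> w0 pS.
have w2 n : 0 <= w / 2 ^+ n by rewrite divr_ge0// exprn_ge0.
have pD n k : p n <= p (n + k)%N /\ p (n + k)%N + w / 2 ^+ (n + k) <= p n + w / 2 ^+ n.
  elim: k => [|k [IH1 IH2]]; first by rewrite addn0 !lexx.
  rewrite addnS.
  have e : w / 2 ^+ (n + k).+1 = w / 2 ^+ (n + k) / 2 by rewrite exprSr invfM mulrA.
  have := w2 (n + k)%N; rewrite e; case: (pS (n + k)%N) => ->; split; lra.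
have pmn m n : p m <= p n + w / 2 ^+ n.
  have [mn|/ltnW nm] := leqP m n.
    have [h1 _] := pD m (n - m)%N; rewrite subnKC// in h1.
    by have := w2 n; lra.
  have [_ h1] := pD n (m - n)%N; rewrite subnKC// in h1.
  by have := w2 m; lra.
have hs : has_sup (range p).
  by split; [exists (p 0%N), 0%N|exists (p 0%N + w / 2 ^+ 0) => _ [m _ <-]].
exists (sup (range p)) => n; apply/andP; split.
  by apply: (ub_le_sup hs.2); exists n.
by apply: ge_sup => [|_ [m _ <-] //]; exact: hs.1.
Qed.

(** Passing to the [n]-th quarter costs a factor [4 ^+ n], and the square of its half-perimeter
    shrinks by the same factor. A bound of second order with arbitrarily small constant near the
    common point therefore forces [0]. *)
Lemma quarter_additive_eq0 J (a c w h : R) : 0 <= w -> 0 <= h -> quarter_additive J ->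
  (forall x y : R, a <= x <= a + w -> c <= y <= c + h -> forall e : R, 0 < e ->
    exists2 d : R, 0 < d & forall x1 y1 w1 h1 : R, 0 <= w1 <= d -> 0 <= h1 <= d ->
      a <= x1 -> x1 + w1 <= a + w -> c <= y1 -> y1 + h1 <= c + h ->
      x1 <= x <= x1 + w1 -> y1 <= y <= y1 + h1 ->
      `|J x1 y1 w1 h1| <= e * (w1 + h1) ^+ 2) ->
  J a c w h = 0.
Proof.
move=> w0 h0 Jadd Jsmall.
have [p [p0 px py pJ]] := quarter_sequence a c w h Jadd.
have [x xP] := dyadic_corner_limit w0 px.
have [y yP] := dyadic_corner_limit h0 py.
have w2 n : 0 <= w / 2 ^+ n by rewrite divr_ge0// exprn_ge0.
have h2 n : 0 <= h / 2 ^+ n by rewrite divr_ge0// exprn_ge0.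
have inQ n : [/\ a <= (p n).1, (p n).1 + w / 2 ^+ n <= a + w, c <= (p n).2 &
    (p n).2 + h / 2 ^+ n <= c + h].
  elim: n => [|n [i1 i2 i3 i4]]; first by rewrite p0 expr0 !divr1 !lexx.
  have e z : z / 2 ^+ n.+1 = z / 2 ^+ n / 2 :> R by rewrite exprSr invfM mulrA.
  rewrite !e; have := w2 n; have := h2 n.
  by case: (px n) => ->; case: (py n) => ->; split; lra.
apply/normr0_eq0/eqP; rewrite eq_le normr_ge0 andbT.
apply/ler_addgt0Pr => e e0; rewrite add0r.
(* The added [1] keeps the divisor positive when [w = h = 0]. *)
have s0 : 0 < (w + h) ^+ 2 + 1 by rewrite ltr_pwDr// sqr_ge0.
have xQ := xP 0%N; have yQ := yP 0%N; rewrite p0 /= expr0 !divr1 in xQ yQ.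
have [d d0 dP] := Jsmall x y xQ yQ (e / ((w + h) ^+ 2 + 1)) (divr_gt0 e0 s0).
have [n nP] : exists n, w / 2 ^+ n <= d /\ h / 2 ^+ n <= d.
  have [n nP] : exists n, (w + h) / 2 ^+ n < d.
    exists (Num.truncn ((w + h) / d)).+1.
    rewrite ltr_pdivrMr ?exprn_gt0// mulrC -ltr_pdivrMr//.
    apply: (lt_trans (truncnS_gt _)).
    by rewrite -natrX ltr_nat ltn_expl.
  exists n; move: nP; rewrite mulrDl; have := w2 n; have := h2 n.
  by split; lra.
have [i1 i2 i3 i4] := inQ n.
have := dP (p n).1 (p n).2 (w / 2 ^+ n) (h / 2 ^+ n).
rewrite w2 h2 nP.1 nP.2 => /(_ isT isT i1 i2 i3 i4 (xP n) (yP n)) Jn.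
apply: (le_trans (pJ n)).
have := ler_wpM2l (exprn_ge0 n (ler0n R 4)) Jn; move=> /le_trans; apply.
have e4 : (2 ^+ n) ^+ 2 = 4 ^+ n :> R by rewrite -exprM mulnC exprM; congr (_ ^+ _); ring.
rewrite -mulrDl expr_div_n e4.
have -> : 4 ^+ n * (e / ((w + h) ^+ 2 + 1) * ((w + h) ^+ 2 / 4 ^+ n)) =
    e * ((w + h) ^+ 2 / ((w + h) ^+ 2 + 1)).
  by field; rewrite expf_neq0 ?gt_eqF//= pnatr_eq0.
apply: ler_piMr; first exact: ltW.
by rewrite ler_pdivrMr// mul1r lerDl.
Qed.
End Bisection.

(** * Vanishing of the circulation of a holomorphic function *)

Section Goursat.
Variable R : realType.

(* [Re (\oint (u + i v) (dx + i dy))] over the boundary of the rectangle, where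
   [U y] and [V x] are primitives of [u ^~ y] and [v x]. *)
Definition rect_circulation (U V : R -> R -> R) (x y w h : R) : R :=
  (U y (x + w) - U y x) - (U (y + h) (x + w) - U (y + h) x)
  - (V (x + w) (y + h) - V (x + w) y) + (V x (y + h) - V x y).

Lemma rect_circulation_additive U V : quarter_additive (rect_circulation U V).
Proof.
move=> x y w h; rewrite /rect_circulation.
have -> : x + w / 2 + w / 2 = x + w by lra.
have -> : y + h / 2 + h / 2 = y + h by lra.
ring.
Qed.

(** Stands for the bound [m * w] on the integral of [p - k] over a segment of length [w]; the mean
    value theorem for [P] gives it without integrating. *)
Lemma primitive_increment_bound (P p : R -> R) (a w k m : R) : 0 <= w ->
  (forall x, a <= x <= a + w -> is_derive x 1 P (p x)) ->
  (forall x, a <= x <= a + w -> `|p x - k| <= m) ->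
  `|P (a + w) - P a - k * w| <= m * w.
Proof.
move=> w0 dP pk.
have ab : a <= a + w by lra.
have [||x xab ->] := @MVT_segment R P p a (a + w) ab.
- by move=> x; rewrite in_itv/= => /andP[h1 h2]; apply: dP; lra.
- apply: derivable_within_continuous => x; rewrite in_itv/= => xab.
  by have [] := dP x xab.
have -> : a + w - a = w by ring.
rewrite -mulrBl normrM (ger0_norm w0) ler_wpM2r// pk//.
Qed.

(** The expansion hypothesis is complex differentiability of [u + i v], with derivative [A + i B].
    On a small rectangle the affine part contributes [B * w1 * h1] to the horizontal and to the
    vertical sides, with opposite signs; only remainders of size [e * (w1 + h1) ^+ 2] survive. *)
Theorem goursat_rectangle (u v U V : R -> R -> R) (a c w h : R) : 0 <= w -> 0 <= h ->
  (forall x y : R, a <= x <= a + w -> c <= y <= c + h ->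
     is_derive x 1 (U y) (u x y) /\ is_derive y 1 (V x) (v x y)) ->
  (forall x y : R, a <= x <= a + w -> c <= y <= c + h ->
     exists A B : R, forall e : R, 0 < e -> exists2 d : R, 0 < d &
     forall x1 y1 : R, a <= x1 <= a + w -> c <= y1 <= c + h ->
       `|x1 - x| <= d -> `|y1 - y| <= d ->
       `|u x1 y1 - u x y - (A * (x1 - x) - B * (y1 - y))|
          <= e * (`|x1 - x| + `|y1 - y|) /\
       `|v x1 y1 - v x y - (B * (x1 - x) + A * (y1 - y))|
          <= e * (`|x1 - x| + `|y1 - y|)) ->
  rect_circulation U V a c w h = 0.
Proof.
move=> w0 h0 dUV CR; apply: quarter_additive_eq0 => //.
  exact: rect_circulation_additive.
move=> x y xQ yQ e e0.
have [A [B AB]] := CR x y xQ yQ.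
(* Halved because a difference across opposite sides collects two remainders. *)
have e2 : 0 < e / 2 by lra.
have [d d0 dP] := AB _ e2.
exists d => // x1 y1 w1 h1 w1d h1d x1a x1w y1c y1h x1x y1y.
have near1 s t : x1 <= s <= x1 + w1 -> y1 <= t <= y1 + h1 ->
    `|u s t - u x y - (A * (s - x) - B * (t - y))| <= e / 2 * (w1 + h1) /\
    `|v s t - v x y - (B * (s - x) + A * (t - y))| <= e / 2 * (w1 + h1).
  move=> sI tI.
  have sx : `|s - x| <= w1 by rewrite ler_norml; apply/andP; split; lra.
  have ty : `|t - y| <= h1 by rewrite ler_norml; apply/andP; split; lra.
  have sum : e / 2 * (`|s - x| + `|t - y|) <= e / 2 * (w1 + h1).
    by apply: ler_wpM2l; [exact: ltW|exact: lerD].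
  have [||||k1 k2] := dP s t; [lra|lra|lra|lra|].
  by split; exact: le_trans sum.
have U1 : `|(U y1 (x1 + w1) - U (y1 + h1) (x1 + w1)) - (U y1 x1 - U (y1 + h1) x1)
    - B * h1 * w1| <= e * (w1 + h1) * w1.
  apply: (@primitive_increment_bound (fun s => U y1 s - U (y1 + h1) s)
     (fun s => u s y1 - u s (y1 + h1))) => [|s sI|s sI]; first by lra.
    have [||d1 _] := dUV s y1; try lra.
    have [||d2 _] := dUV s (y1 + h1); try lra.
    exact: is_deriveB.
  have [|] := near1 s y1 sI; first lra.
  have [|] := near1 s (y1 + h1) sI; first lra.
  rewrite !ler_norml => /andP[p1 p2] _ /andP[p3 p4] _.
  by apply/andP; split; lra.
have V1 : `|(V (x1 + w1) (y1 + h1) - V x1 (y1 + h1)) - (V (x1 + w1) y1 - V x1 y1)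
    - B * w1 * h1| <= e * (w1 + h1) * h1.
  apply: (@primitive_increment_bound (fun t => V (x1 + w1) t - V x1 t)
     (fun t => v (x1 + w1) t - v x1 t)) => [|t tI|t tI]; first by lra.
    have [||_ d1] := dUV (x1 + w1) t; try lra.
    have [||_ d2] := dUV x1 t; try lra.
    exact: is_deriveB.
  have [||_] := near1 (x1 + w1) t; try lra.
  have [||_] := near1 x1 t; try lra.
  rewrite !ler_norml => /andP[p1 p2] /andP[p3 p4].
  by apply/andP; split; lra.
move: U1 V1; rewrite /rect_circulation !ler_norml => /andP[p1 p2] /andP[p3 p4].
by apply/andP; split; lra.
Qed.
End Goursat.

(** * Logarithmic polar coordinates *)

Section Polar.
Variable R : realType.
Local Notation C := (Cplx R).
Local Notation ReC := (@complex.Re R).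
Local Notation ImC := (@complex.Im R).

Lemma is_derive_expansion (f : R -> R) (x a : R) : is_derive x 1 f a ->
  forall e : R, 0 < e -> exists2 d : R, 0 < d & forall h : R, `|h| < d ->
    `|f (x + h) - f x - a * h| <= e * `|h|.
Proof.
move=> [df Df] e e0.
have nD : nbhs ('D_1 f x) (ball ('D_1 f x) e) by exact: nbhsx_ballx.
have /nbhs_ballP[d /= d0 dP] := df _ nD.
exists d => // h hd; have [->|h0] := eqVneq h 0.
  by rewrite mulr0 subr0 addr0 subrr normr0 mulr0 lexx.
have := dP h; rewrite -ball_normE/= sub0r normrN => /(_ hd h0).
rewrite Df -[h *: 1]/(h * 1) mulr1 -[_ *: _]/(h^-1 * (f (h + x) - f x)) distrC.
have -> : f (x + h) - f x - a * h = (h^-1 * (f (h + x) - f x) - a) * h.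
  by rewrite mulrBl mulrAC mulVf// mul1r [h + x]addrC.
by move=> /ltW ?; rewrite normrM ler_wpM2r.
Qed.

Definition polar (s t : R) : C := (expR s * cos t +i* (expR s * sin t))%C.

Lemma cmod_polar s t : cmod (polar s t) = expR s.
Proof.
rewrite cmodE /= !exprMn -mulrDr cos2Dsin2 mulr1 sqrtr_sqr.
by rewrite ger0_norm// expR_ge0.
Qed.

Lemma polarD s t s1 t1 : polar (s + s1) (t + t1) = polar s t * polar s1 t1.
Proof.
rewrite /polar expRD cosD sinD; apply/eqP; rewrite eq_complex/=.
by apply/andP; split; apply/eqP; ring.
Qed.

Lemma polar_neq0 s t : polar s t != 0.
Proof. by rewrite -cmod_gt0 cmod_polar expR_gt0. Qed.

Lemma polar_2pi s : polar s (2 * pi) = polar s 0.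
Proof. by rewrite /polar mulr_natl cos2pi sin2pi cos0 sin0. Qed.

(** Complex differentiability of the exponential at [0], put together from the real derivatives of
    [expR], [cos] and [sin]; [polarD] carries it to other points. *)
Lemma polar_expansion0 (e : R) : 0 < e -> exists2 d : R, 0 < d &
  forall h k : R, `|h| < d -> `|k| < d ->
    cmod (polar h k - 1 - (h +i* k)%C) <= e * (`|h| + `|k|).
Proof.
(* The condition [e1 <= 1] yields [|expR h| <= 3], and [|h| < e1] absorbs the product [h * k]. The
   errors then add up to at most [e1 * |h| + 8 * e1 * |k|], well below the target thanks to the
   factor [20]. *)
move=> e0; pose e1 := Num.min 1 (e / 20).
have e1_gt0 : 0 < e1 by rewrite lt_min ltr01 divr_gt0.
have e1le : e1 <= e / 20 by rewrite ge_min lexx orbT.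
have e1le1 : e1 <= 1 by rewrite ge_min lexx.
clearbody e1.
have [d1 d1_gt0 P1] := is_derive_expansion (is_derive_expR (0 : R)) e1_gt0.
have [d2 d2_gt0 P2] := is_derive_expansion (is_derive_cos (0 : R)) e1_gt0.
have [d3 d3_gt0 P3] := is_derive_expansion (is_derive_sin (0 : R)) e1_gt0.
exists (Num.min (Num.min d1 d2) (Num.min d3 e1)).
  by rewrite !lt_min d1_gt0 d2_gt0 d3_gt0 e1_gt0.
move=> h k; rewrite !lt_min => /andP[/andP[h1 _] /andP[_ h4]].
move=> /andP[/andP[_ k2] /andP[k3 k4]].
move: (P1 h h1) (P2 k k2) (P3 k k3).
rewrite !add0r expR0 cos0 sin0 mul1r oppr0 mul0r !subr0 mul1r addr0.
set E := expR h; set c := cos k; set s := sin k => HE Hc Hs.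
have Eb : `|E| <= 3.
  have -> : E = (E - 1 - h) + (1 + h) by ring.
  apply: (le_trans (ler_normD _ _)); apply: (le_trans (lerD HE (ler_normD _ _))).
  rewrite normr1.
  have : e1 * `|h| <= 1 * 1 by apply: ler_pM => //; lra.
  lra.
apply: (le_trans (cmod_le_ReIm _)) => /=; rewrite oppr0 addr0.
have -> : E * c + - 1 + - h = (E - 1 - h) + E * (c - 1) by ring.
have -> : E * s + - k = E * (s - k) + ((E - 1 - h) * k + h * k) by ring.
have b1 : `|E * (c - 1)| <= 3 * (e1 * `|k|) by rewrite normrM ler_pM.
have b2 : `|E * (s - k)| <= 3 * (e1 * `|k|) by rewrite normrM ler_pM.
have b3 : `|(E - 1 - h) * k| <= e1 * `|k|.
  rewrite normrM ler_pM//; apply: (le_trans HE).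
  by apply: ler_piMr; [exact: ltW|apply/ltW/(lt_le_trans h4)].
have b4 : `|h * k| <= e1 * `|k| by rewrite normrM ler_wpM2r// ltW.
have := ler_normD (E - 1 - h) (E * (c - 1)).
have := ler_normD (E * (s - k)) ((E - 1 - h) * k + h * k).
have := ler_normD ((E - 1 - h) * k) (h * k).
have h0 := normr_ge0 h; have k0 := normr_ge0 k.
have q1 : e1 * `|h| <= e / 20 * `|h| by rewrite ler_wpM2r.
have q2 : e1 * `|k| <= e / 20 * `|k| by rewrite ler_wpM2r.
have q3 : 0 <= e / 20 * `|h| by rewrite mulr_ge0// divr_ge0// ltW.
have q4 : 0 <= e / 20 * `|k| by rewrite mulr_ge0// divr_ge0// ltW.
lra.
Qed.

Lemma cmod_Complex_le (h k : R) : cmod (h +i* k : C)%C <= `|h| + `|k|.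
Proof. exact: cmod_le_ReIm. Qed.

(** Chain rule for [q(exp(s + i t))] in the expansion form that Goursat's theorem asks for; the
    derivative is [q'(z) * z] since the exponential is its own derivative. *)
Lemma comp_polar_expansion (q : C -> C) (s t : R) : derivable q (polar s t) 1 ->
  exists A : C, forall e : R, 0 < e -> exists2 d : R, 0 < d &
  forall s1 t1 : R, `|s1 - s| <= d -> `|t1 - t| <= d ->
    cmod (q (polar s1 t1) - q (polar s t) - A * ((s1 - s) +i* (t1 - t))%C)
      <= e * (`|s1 - s| + `|t1 - t|).
Proof.
move=> dq; set z := polar s t; set D := 'D_1 q z.
exists (D * z) => e e0.
have m0 := cmod_ge0 z; have n0 := cmod_ge0 D.
pose e1 := e / (2 * (cmod z + 1)).
have e1_gt0 : 0 < e1 by rewrite divr_gt0//; lra.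
have [d1 d1_gt0 P1] := derivable_expansion dq e1_gt0.
(* Two demands on [e2]: [cmod z * e2 <= 1], so that the increment [w] is bounded linearly, and
   [cmod D * cmod z * e2 <= e / 2], so that the remainder of the exponential takes half of the
   error. *)
pose e2 := Num.min 1 (e / (2 * (cmod D + 1))) / (cmod z + 1).
have e2_gt0 : 0 < e2 by rewrite divr_gt0 ?lt_min ?ltr01 ?divr_gt0//; lra.
have e2a : cmod z * e2 <= 1.
  rewrite /e2 mulrA ler_pdivrMr; last lra.
  rewrite mul1r; set mm := Num.min _ _.
  have : cmod z * mm <= cmod z * 1 by rewrite ler_wpM2l// ge_min lexx.
  lra.
have e2b : cmod D * (cmod z * e2) <= e / 2.
  rewrite /e2; set mm := Num.min _ _.
  have mm0 : 0 <= mm by rewrite le_min ler01 divr_ge0 ?ltW//; lra.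
  have mme : mm <= e / (2 * (cmod D + 1)) by rewrite ge_min lexx orbT.
  have -> : cmod D * (cmod z * (mm / (cmod z + 1))) =
     (cmod D * mm) * (cmod z / (cmod z + 1)) by ring.
  have z1 : cmod z / (cmod z + 1) <= 1 by rewrite ler_pdivrMr; lra.
  have z2 : 0 <= cmod z / (cmod z + 1) by rewrite divr_ge0//; lra.
  apply: (@le_trans _ _ (cmod D * mm)); first by rewrite ler_piMr// mulr_ge0.
  apply: (@le_trans _ _ (cmod D * (e / (2 * (cmod D + 1))))).
    by rewrite ler_wpM2l.
  have -> : cmod D * (e / (2 * (cmod D + 1))) = (e / 2) * (cmod D / (cmod D + 1)).
    by field; lra.
  rewrite ler_piMr//; first lra.
  by rewrite ler_pdivrMr; lra.
have [d2 d2_gt0 P2] := polar_expansion0 e2_gt0.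
(* With [|h|] and [|k|] below [d3], the increment [w] has modulus at most [d1 / 2]. *)
pose d3 := d1 / (4 * (cmod z + 1)).
have d3_gt0 : 0 < d3 by rewrite divr_gt0//; lra.
exists (Num.min d2 d3 / 2); first by rewrite divr_gt0 // lt_min d2_gt0.
move=> s1 t1; set h := s1 - s; set k := t1 - t => hd kd.
have mind : Num.min d2 d3 / 2 < Num.min d2 d3.
  have : 0 < Num.min d2 d3 by rewrite lt_min d2_gt0.
  lra.
have hlt := le_lt_trans hd mind; have klt := le_lt_trans kd mind.
rewrite lt_min in hlt; rewrite lt_min in klt.
have {hlt} [hlt2 hlt3] := andP hlt; have {klt} [klt2 klt3] := andP klt.
have := P2 h k hlt2 klt2; set rho := polar h k - 1 - _ => Hrho.
have -> : polar s1 t1 = z + z * ((h +i* k)%C + rho).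
  have -> : s1 = s + h by rewrite /h; ring.
  have -> : t1 = t + k by rewrite /k; ring.
  rewrite polarD -/z.
  have -> : polar h k = 1 + ((h +i* k)%C + rho) by rewrite /rho; ring.
  by ring.
set w := z * _.
have hk0 : 0 <= `|h| + `|k| by rewrite addr_ge0.
have zrho : cmod (z * rho) <= (cmod z * e2) * (`|h| + `|k|).
  by rewrite cmodM -mulrA ler_wpM2l.
have wb : cmod w <= (cmod z + 1) * (`|h| + `|k|).
  rewrite /w mulrDr; apply: (le_trans (cmodD _ _)).
  rewrite mulrDl; apply: lerD.
    by rewrite cmodM ler_wpM2l// cmod_Complex_le.
  by apply: (le_trans zrho); rewrite ler_wpM2r.
have wd : cmod w < d1.
  apply: (le_lt_trans wb).
  have z1 : 0 < cmod z + 1 by lra.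
  rewrite mulrC -ltr_pdivlMr//.
  have : d3 * 4 = d1 / (cmod z + 1) by rewrite /d3; field; lra.
  lra.
have := P1 w wd; rewrite -/D => H1.
have -> : q (z + w) - q z - D * z * (h +i* k)%C =
  (q (z + w) - q z - D * w) + D * (z * rho) by rewrite /w; ring.
apply: (le_trans (cmodD _ _)); rewrite cmodM.
have H2 : cmod D * cmod (z * rho) <= e / 2 * (`|h| + `|k|).
  apply: (le_trans (ler_wpM2l n0 zrho)); rewrite mulrA.
  by rewrite ler_wpM2r.
have H3 : e1 * cmod w <= e / 2 * (`|h| + `|k|).
  apply: (le_trans (ler_wpM2l (ltW e1_gt0) wb)); rewrite mulrA.
  have -> : e1 * (cmod z + 1) = e / 2 by rewrite /e1; field; lra.
  by [].
lra.
Qed.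
End Polar.

(** * The mean value property *)

Section MeanValue.
Variable R : realType.
Local Notation C := (Cplx R).
Local Notation ReC := (@complex.Re R).
Local Notation ImC := (@complex.Im R).
Local Notation mu := (@lebesgue_measure R).

(** The base point [lo] is later taken strictly to the left of the interval of interest, so that
    derivatives at its endpoints are two-sided. *)
Definition primitive_from (lo : R) (p : R -> R) (x : R) : R :=
  (\int[mu]_(t in `[lo, x]) p t)%R.

Lemma is_derive_primitive_from (p : R -> R) (lo hi x : R) :
  (forall y : R, lo <= y <= hi -> {for y, continuous p}) -> lo < x < hi ->
  is_derive x 1 (primitive_from lo p) (p x).
Proof.
move=> pc /andP[lox xhi].
have pi : mu.-integrable `[lo, hi] (EFin \o p).
  apply: continuous_compact_integrable; first exact: segment_compact.
  apply: continuous_in_subspaceT => y; rewrite inE/= in_itv/=; exact: pc.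
have px : {for x, continuous p} by apply: pc; rewrite !ltW.
have [d D] := continuous_FTC1_closed xhi pi lox px.
by split; [exact: d|rewrite -derive1E].
Qed.

Lemma continuous_polar_s (t s : R) : {for s, continuous (fun x => polar x t : C)}.
Proof.
apply: continuous_Complex; apply: continuousM => //;
  by [exact: continuous_expR|exact: cst_continuous].
Qed.

Lemma continuous_polar_t (s t : R) : {for t, continuous (polar s : R -> C)}.
Proof.
apply: continuous_Complex; apply: continuousM => //;
  by [exact: cst_continuous|exact: continuous_cos|exact: continuous_sin].
Qed.

Variable q : C -> C.
Hypothesis q_cont0 : {for 0, continuous q}.
Hypothesis q_diff : forall z : C, z != 0 -> cmod z < 1 -> derivable q z 1.

Lemma derivable_continuous_at (f : C -> C) z : derivable f z 1 -> {for z, continuous f}.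
Proof. by move=> /derivable1_diffP; exact: differentiable_continuous. Qed.

Let q_polar s t : s < 0 -> derivable q (polar s t) 1.
Proof.
move=> s0; apply: q_diff; first exact: polar_neq0.
by rewrite cmod_polar -(@expR0 R) ltr_expR.
Qed.

Let Vprim (s : R) := primitive_from (-1) (fun t => - ReC (q (polar s t))).

Let is_derive_Vprim s t : s < 0 -> 0 <= t <= 2 * pi ->
  is_derive t 1 (Vprim s) (- ReC (q (polar s t))).
Proof.
move=> s0 tI.
apply: (@is_derive_primitive_from _ (-1) (2 * pi + 1)); last by lra.
move=> y _; apply: continuousN.
apply: (@continuous_comp _ _ _ (fun t => q (polar s t)) ReC).
  apply: (@continuous_comp _ _ _ (polar s) q); first exact: continuous_polar_t.
  exact/derivable_continuous_at/q_polar.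
exact: continuous_ReC.
Qed.

(** Goursat's theorem for [-i q(exp(s + i t))], whose parts are [Im q] and [- Re q]. By
    [2 pi]-periodicity the two horizontal sides cancel, and the vertical ones are integrals over the
    two circles. *)
Lemma circle_increment_const s1 s2 : s1 <= s2 -> s2 < 0 ->
  Vprim s2 (2 * pi) - Vprim s2 0 = Vprim s1 (2 * pi) - Vprim s1 0.
Proof.
move=> s12 s20.
pose U (t : R) := primitive_from (s1 - 1) (fun s => ImC (q (polar s t))).
have pi0 : 0 <= 2 * pi :> R by rewrite mulr_ge0// pi_ge0.
have := @goursat_rectangle R (fun s t => ImC (q (polar s t)))
  (fun s t => - ReC (q (polar s t))) U Vprim s1 0 (s2 - s1) (2 * pi).
have -> : s1 + (s2 - s1) = s2 by ring.
rewrite !add0r subr_ge0 s12 pi0 => /(_ isT isT) G.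
suff : rect_circulation U Vprim s1 0 (s2 - s1) (2 * pi) = 0.
  rewrite /rect_circulation !add0r.
  have -> : s1 + (s2 - s1) = s2 by ring.
  have -> : U (2 * pi) = U 0.
    by rewrite /U; congr primitive_from; apply/funext => s; rewrite polar_2pi.
  by rewrite subrr sub0r addrC => /eqP; rewrite subr_eq0 => /eqP.
apply: G => s t sI tI.
  split; last by apply: is_derive_Vprim => //; lra.
  apply: (@is_derive_primitive_from _ (s1 - 1) (s2 / 2)); last by lra.
  move=> y yI.
  apply: (@continuous_comp _ _ _ (fun s => q (polar s t)) ImC).
    apply: (@continuous_comp _ _ _ (fun s => polar s t) q).
      exact: continuous_polar_s.
    by apply/derivable_continuous_at/q_polar; lra.
  exact: continuous_ImC.
have [|A AP] := @comp_polar_expansion R q s t; first by apply: q_polar; lra.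
exists (ImC A), (- ReC A) => e e0; have [d d0 dP] := AP e e0.
exists d => // x y _ _ xd yd; have := dP x y xd yd.
set rho := _ - _ => rb; split.
  apply: le_trans rb; apply: le_trans (Im_le_cmod _).
  rewrite /rho !ImB; case: (A) => a b /=.
  by rewrite le_eqVlt; apply/orP; left; apply/eqP; congr `|_|; ring.
apply: le_trans rb; apply: le_trans (Re_le_cmod _).
rewrite /rho !ReB; case: (A) => a b /=; rewrite -[leRHS]normrN.
by rewrite le_eqVlt; apply/orP; left; apply/eqP; congr `|_|; ring.
Qed.

(** The increment may be computed on a circle so small that [q] is within [e / (2 * pi)] of [q 0]
    there, which leaves an error of at most [e]. *)
Lemma circle_increment s : s < 0 ->
  Vprim s (2 * pi) - Vprim s 0 = - ReC (q 0) * (2 * pi).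
Proof.
move=> s0.
have pi_gt0 : 0 < 2 * pi :> R by rewrite mulr_gt0// pi_gt0.
apply/eqP; rewrite -subr_eq0 -normr_le0; apply/ler_addgt0Pr => e e0.
rewrite add0r.
have e1 : 0 < e / (2 * pi) by rewrite divr_gt0.
have /continuous_cmodP/(_ _ e1)[d d0 dP] := q_cont0.
pose s1 := Num.min s (ln (d / 2)).
have s1s : s1 <= s by rewrite ge_min lexx.
have s1d : expR s1 < d.
  apply: (@le_lt_trans _ _ (d / 2)); last lra.
  have d2 : 0 < d / 2 by lra.
  rewrite -[leRHS]lnK ?posrE// ler_expR ge_min lexx orbT //.
rewrite (circle_increment_const s1s s0).
have := @primitive_increment_bound R (Vprim s1) (fun t => - ReC (q (polar s1 t)))
  0 (2 * pi) (- ReC (q 0)) (e / (2 * pi)) (ltW pi_gt0).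
rewrite add0r divfK ?gt_eqF//; apply => t tI.
  by apply: is_derive_Vprim => //; lra.
rewrite opprK addrC -ReB; apply: le_trans (Re_le_cmod _) _.
rewrite cmodB; apply/ltW/dP.
by rewrite subr0 cmod_polar.
Qed.

Lemma circle_mean s : s < 0 -> exists P : R -> R,
  (forall t : R, 0 <= t <= 2 * pi -> is_derive t 1 P (ReC (q (polar s t)))) /\
  P (2 * pi) - P 0 = ReC (q 0) * (2 * pi).
Proof.
move=> s0; exists (fun t => - Vprim s t); split=> [t tI|].
  have := is_deriveN (is_derive_Vprim s0 tI); rewrite opprK; exact.
by have := circle_increment s0; lra.
Qed.

(** The mean value theorem for the primitive [P] turns the circle mean into a value taken on the
    circle; this weak form suffices for the maximum principle. *)
Lemma mean_value_attained (r : R) : 0 < r < 1 ->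
  exists2 z : C, cmod z = r & ReC (q z) = ReC (q 0).
Proof.
move=> /andP[r0 r1].
have s0 : ln r < 0 by rewrite ln_lt0// r0.
have [P [dP PE]] := circle_mean s0.
have pi_gt0 : 0 < 2 * pi :> R by rewrite mulr_gt0// pi_gt0.
have [||t _] := @MVT R P (fun t => ReC (q (polar (ln r) t))) 0 (2 * pi) pi_gt0.
- by move=> t; rewrite in_itv/= => /andP[? ?]; apply: dP; lra.
- apply: derivable_within_continuous => t; rewrite in_itv/= => tI.
  by have [] := dP t tI.
rewrite subr0 PE => /(mulIf (lt0r_neq0 pi_gt0)) E.
by exists (polar (ln r) t); rewrite ?cmod_polar ?lnK.
Qed.

(** The function [H] is nondecreasing with equal end values, so its derivative vanishes at the
    interior point [t = pi], which is [- r] on the circle. Rotations bring every other point to this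
    position. *)
Lemma mean_value_rigidity (r : R) : 0 < r < 1 ->
  (forall z : C, cmod z = r -> ReC (q z) <= ReC (q 0)) ->
  ReC (q (- r%:C%C)) = ReC (q 0).
Proof.
move=> /andP[r0 r1] qle.
have s0 : ln r < 0 by rewrite ln_lt0// r0.
have [P [dP PE]] := circle_mean s0.
have p0 : (0 : R) < pi by exact: pi_gt0.
pose H t := ReC (q 0) * t - P t.
have dH (t : R) : 0 <= t <= 2 * pi ->
    is_derive t 1 H (ReC (q 0) - ReC (q (polar (ln r) t))).
  move=> tI; have d1 := dP t tI.
  have d2 : is_derive t 1 ( *%R (ReC (q 0))) (ReC (q 0)).
    have := is_deriveZ (ReC (q 0)) (is_derive_id t (1 : R)).
    by rewrite -[_ *: 1]/(_ * 1) mulr1.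
  exact: (is_deriveB d2 d1).
have dH0 (t : R) : 0 <= ReC (q 0) - ReC (q (polar (ln r) t)).
  by rewrite subr_ge0 qle// cmod_polar lnK.
have Hmono (a b : R) : 0 <= a -> a <= b -> b <= 2 * pi -> H a <= H b.
  move=> a0 ab b2.
  have [||t _ E] := @MVT_segment R H (fun t => ReC (q 0) - ReC (q (polar (ln r) t))) a b ab.
  - by move=> t; rewrite in_itv/= => /andP[? ?]; apply: dH; lra.
  - apply: derivable_within_continuous => t; rewrite in_itv/= => /andP[? ?].
    by have [|] := dH t; first lra.
  by rewrite -subr_ge0 E mulr_ge0// subr_ge0.
have HE : H (2 * pi) = H 0 by rewrite /H; lra.
have piI : (0 : R) <= pi <= (2 * pi : R) by lra.
have [_ D1] := dH pi piI.
have : is_derive pi 1 H 0.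
  apply: (@derive1_at_max _ H 0 (2 * pi)) => [|t||t]; rewrite ?in_itv/=.
  - lra.
  - by move=> /andP[? ?]; have [|] := dH t; first lra.
  - lra.
  - move=> /andP[t0 t1].
    apply: (@le_trans _ _ (H (2 * pi))); first by apply: Hmono; lra.
    by rewrite HE; apply: Hmono; lra.
move=> [_]; rewrite D1 => /eqP; rewrite subr_eq0 => /eqP ->.
congr (ReC (q _)); rewrite /polar cospi sinpi lnK ?posrE//.
by apply/eqP; rewrite eq_complex/= mulr0 mulrN1 oppr0 !eqxx.
Qed.
End MeanValue.

(** * Difference quotients and maxima on closed discs *)

Section ComplexCalculus.
Variable R : realType.
Local Notation C := (Cplx R).
Local Notation ReC := (@complex.Re R).
Local Notation ImC := (@complex.Im R).

Lemma derivable_comp_affine (f : C -> C) (a b z : C) :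
  derivable f (a + b * z) 1 -> derivable (fun w : C => f (a + b * w)) z 1.
Proof.
move=> /derivable1_diffP df; apply/derivable1_diffP.
have da : differentiable (fun w : C => a + b * w : C) z.
  apply: (@differentiableD _ _ _ (cst a) (fun w : C => b * w : C)).
    exact: differentiable_cst.
  exact: (@differentiableM R[i] _ (cst (b : R[i])) id z (differentiable_cst _ _) ex_diff).
exact: (@differentiable_comp _ _ _ _ (fun w : C => a + b * w : C) f z da df).
Qed.

Lemma derive_unique (f : C -> C) (z A : C) : derivable f z 1 ->
  (forall e : R, 0 < e -> exists2 d : R, 0 < d & forall h : C, cmod h < d ->
    cmod (f (z + h) - f z - A * h) <= e * cmod h) ->
  'D_1 f z = A.
Proof.
move=> df fA; apply/eqP; rewrite -subr_eq0 -cmod_eq0 eq_le cmod_ge0 andbT.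
apply/ler_addgt0Pr => e e0; rewrite add0r.
have e2 : 0 < e / 2 by lra.
have [d1 d10 P1] := derivable_expansion df e2.
have [d2 d20 P2] := fA _ e2.
pose d := Num.min d1 d2 / 2.
have [dd1 dd2 d0] : [/\ d < d1, d < d2 & 0 < d].
  have m0 : 0 < Num.min d1 d2 by rewrite lt_min d10.
  have m1 : Num.min d1 d2 <= d1 by rewrite ge_min lexx.
  have m2 : Num.min d1 d2 <= d2 by rewrite ge_min lexx orbT.
  by rewrite /d; split; lra.
have hE : cmod (d%:C%C : C) = d by rewrite cmod_real gtr0_norm.
have := P1 (d%:C)%C; have := P2 (d%:C)%C; rewrite hE => /(_ dd2) k2 /(_ dd1) k1.
rewrite -(ler_pM2r d0) -{1}hE -cmodM.
set w := d%:C%C in k1 k2 *.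
have -> : ('D_1 f z - A) * w =
   (f (z + w) - f z - A * w) - (f (z + w) - f z - 'D_1 f z * w) by ring.
by apply: (le_trans (cmodD _ _)); rewrite cmodN; lra.
Qed.

(** For [G 0 = 0] this is the difference quotient at [0], completed by its limit. *)
Definition slope0 (G : C -> C) (z : C) : C := if z == 0 then 'D_1 G 0 else G z / z.

Lemma continuous_slope0 (G : C -> C) : derivable G 0 1 -> G 0 = 0 ->
  {for 0, continuous (slope0 G)}.
Proof.
move=> dG G0; apply/continuous_cmodP => e e0.
have e2 : 0 < e / 2 by lra.
have [d d0 dP] := derivable_expansion dG e2.
exists d => // w; rewrite subr0 => wd; rewrite /slope0 eqxx.
have [_|w0] := eqVneq w 0; first by rewrite subrr cmod0.
have := dP w wd; rewrite add0r G0 subr0 => k.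
have wp : 0 < cmod w by rewrite cmod_gt0.
rewrite -(ltr_pM2r wp) -cmodM mulrBl divfK//.
by apply: (le_lt_trans k); rewrite ltr_pM2r//; lra.
Qed.

Lemma derivable_slope0 (G : C -> C) (z : C) : derivable G z 1 -> z != 0 ->
  derivable (slope0 G) z 1.
Proof.
move=> dG z0.
have : derivable (fun w : C => G w * w^-1 : C) z 1.
  apply: (@derivableM _ _ G (fun w : C => w^-1 : C) z); first exact: dG.
  exact: (@derivableV R[i] _ id z 1 z0 (@derivable_id _ _ _ _)).
apply: near_eq_derivable.
apply/nbhs_cmodP; exists (cmod z); first by rewrite cmod_gt0.
move=> w wz; rewrite /slope0; case: eqVneq => // w0.
by move: wz; rewrite w0 sub0r cmodN ltxx.
Qed.

(** Compactness comes from [R * R], where the disc is a closed subset of a product of segments; [cx]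
    carries the maximum over to [C]. *)
Lemma closed_disc_argmax (F : C -> R) (r : R) : 0 <= r ->
  (forall z : C, cmod z <= r -> {for z, continuous F}) ->
  exists2 z0 : C, cmod z0 <= r & forall z : C, cmod z <= r -> F z <= F z0.
Proof.
move=> r0 Fc.
pose N (p : R * R) : R := p.1 ^+ 2 + p.2 ^+ 2.
pose cx (p : R * R) : C := (p.1 +i* p.2)%C.
pose K := [set p : R * R | N p <= r ^+ 2].
have KE p : (cmod (cx p) <= r) = (N p <= r ^+ 2).
  by rewrite -(@ler_pXn2r _ 2)// ?nnegrE ?cmod_ge0// sqr_cmod.
have Nc : continuous N.
  move=> p; apply: (@continuousD R R^o (R * R)%type (fun p => p.1 ^+ 2) (fun p => p.2 ^+ 2)).
    apply: (@continuous_comp _ _ _ fst (fun x : R => x ^+ 2)); first exact: cvg_fst.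
    exact: exprn_continuous.
  apply: (@continuous_comp _ _ _ snd (fun x : R => x ^+ 2)); first exact: cvg_snd.
  exact: exprn_continuous.
have Kclosed : closed K.
  exact: (closed_comp (fun p _ => Nc p) (@closed_le R (r ^+ 2))).
have Kc : compact K.
  apply: (@subclosed_compact _ _ (`[- r, r]%classic `*` `[- r, r]%classic)) => //.
    by apply: compact_setX; exact: segment_compact.
  move=> p; rewrite /K/= -KE /= !in_itv/= -!ler_norml => pr.
  split; first exact: le_trans (Re_le_cmod _) pr.
  exact: le_trans (Im_le_cmod _) pr.
have [||p0 p0K p0max] := @compact_EVT_max _ R (F \o cx) K _ Kc.
- by exists (0, 0); rewrite /K/= /N/= !expr0n/= addr0 sqr_ge0.
- apply: continuous_in_subspaceT => p; rewrite inE => pK.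
  apply: continuous_comp; last by apply: Fc; rewrite KE.
  by apply: continuous_Complex; [exact: cvg_fst|exact: cvg_snd].
rewrite inE in p0K.
exists (cx p0); first by rewrite KE.
move=> [x y] zr; have := p0max (x, y); rewrite inE; apply.
by rewrite /K/= -KE.
Qed.
End ComplexCalculus.

(** * The maximum principle and Schwarz's lemma *)

Section MaximumPrinciple.
Variable R : realType.
Local Notation C := (Cplx R).
Local Notation ReC := (@complex.Re R).
Local Notation ImC := (@complex.Im R).

Definition punctured_holomorphic (q : C -> C) : Prop :=
  {for 0, continuous q} /\
  forall z : C, z != 0 -> cmod z < 1 -> derivable q z 1.

Lemma punctured_holomorphic_continuous q z : punctured_holomorphic q ->
  cmod z < 1 -> {for z, continuous q}.
Proof.
move=> [q0 dq] z1; have [->//|zn0] := eqVneq z 0.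
exact/derivable_continuous_at/dq.
Qed.

Lemma continuous_comp_affine (f : C -> C) (a b z : C) :
  {for a + b * z, continuous f} -> {for z, continuous (fun w : C => f (a + b * w))}.
Proof.
move=> /continuous_cmodP fc; apply/continuous_cmodP => e e0.
have [d d0 dP] := fc e e0.
have b1 : 0 < cmod b + 1 by have := cmod_ge0 b; lra.
exists (d / (cmod b + 1)); first exact: divr_gt0.
move=> w; rewrite ltr_pdivlMr// => wd; apply: dP.
have -> : a + b * w - (a + b * z) = b * (w - z) by ring.
rewrite cmodM; apply: le_lt_trans wd.
by rewrite mulrC ler_wpM2l ?cmod_ge0// lerDl.
Qed.

Lemma derivable_lin (b z : C) : derivable (fun w : C => b * w : C) z 1.
Proof.
apply/derivable1_diffP.
exact: (@differentiableM R[i] _ (cst (b : R[i])) id z (differentiable_cst _ _) ex_diff).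
Qed.

Lemma derivable_scale (f : C -> C) (b z : C) : derivable f z 1 ->
  derivable (fun w : C => b * f w : C) z 1.
Proof. by move=> df; exact: (@derivableZ _ _ _ f b z 1 df). Qed.

Lemma continuous_scale (f : C -> C) (b z : C) : {for z, continuous f} ->
  {for z, continuous (fun w : C => b * f w : C)}.
Proof.
move=> /continuous_cmodP fc; apply/continuous_cmodP => e e0.
have b1 : 0 < cmod b + 1 by have := cmod_ge0 b; lra.
have [d d0 dP] := fc _ (divr_gt0 e0 b1).
exists d => // w /dP; rewrite ltr_pdivlMr// => wd.
rewrite -mulrBr cmodM; apply: le_lt_trans wd.
by rewrite mulrC ler_wpM2l ?cmod_ge0// lerDl.
Qed.

Lemma punctured_holomorphic_scale q b : punctured_holomorphic q ->
  punctured_holomorphic (fun w : C => b * q w : C).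
Proof.
move=> [q0 dq]; split; first exact: continuous_scale.
by move=> z z0 z1; apply: derivable_scale; exact: dq.
Qed.

Lemma sqr_cmodD (z w : C) :
  cmod (z + w) ^+ 2 = cmod z ^+ 2 + 2 * ReC ((z^*)%C * w) + cmod w ^+ 2.
Proof. by rewrite !sqr_cmod; case: z => a b; case: w => c d /=; ring. Qed.

Theorem maximum_principle_Re q (r M : R) : punctured_holomorphic q -> 0 < r < 1 ->
  (forall z : C, cmod z = r -> ReC (q z) <= M) ->
  forall z : C, cmod z <= r -> ReC (q z) <= M.
Proof.
move=> hq /andP[r0 r1] qM z1 z1r; rewrite leNgt; apply/negP => qz1.
pose e := (ReC (q z1) - M) / 2.
have e0 : 0 < e by rewrite divr_gt0// subr_gt0.
(* Perturbing by [e |z|^2] makes the real part strictly subharmonic, so that an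
   interior maximum contradicts the mean value property. *)
pose F (z : C) : R := ReC (q z) + e * cmod z ^+ 2.
have [|z0 z0r z0max] := @closed_disc_argmax R F r (ltW r0).
  move=> z zr; have z1' := le_lt_trans zr r1.
  apply: (@continuousD R R^o C (fun z => ReC (q z)) (fun z => e * cmod z ^+ 2)).
    apply: (@continuous_comp _ _ _ q ReC); last exact: continuous_ReC.
    exact: punctured_holomorphic_continuous.
  have -> : (fun z : C => e * cmod z ^+ 2) =
      (fun z : C => e * (ReC z ^+ 2 + ImC z ^+ 2)).
    by apply/funext => w; rewrite sqr_cmod.
  apply: (@continuousM R C (cst e)); first exact: cst_continuous.
  apply: (@continuousD R R^o C (fun z => ReC z ^+ 2) (fun z => ImC z ^+ 2)).
    apply: (@continuous_comp _ _ _ (ReC : C -> R) (fun x : R => x ^+ 2)).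
      exact: continuous_ReC.
    exact: exprn_continuous.
  apply: (@continuous_comp _ _ _ (ImC : C -> R) (fun x : R => x ^+ 2)).
    exact: continuous_ImC.
  exact: exprn_continuous.
(* On the circle [F <= M + e * r ^+ 2 <= M + e], while [F z1 >= M + 2 * e]; hence the maximum is
   interior. *)
have z0lt : cmod z0 < r.
  rewrite lt_neqAle z0r andbT; apply/eqP => z0E.
  have := z0max z1 z1r; rewrite /F z0E.
  have := qM z0 z0E.
  have r2 : r ^+ 2 <= 1 by rewrite expr_le1 ?ltW.
  have : e * r ^+ 2 <= e * 1 by rewrite ler_wpM2l// ltW.
  have : 0 <= e * cmod z1 ^+ 2 by rewrite mulr_ge0 ?sqr_ge0// ltW.
  rewrite /e; lra.
(* The disc of radius [rho] about [z0] stays in [|z| <= r], and its open part contains [0] only if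
   [0] is its centre, where continuity of [q] is enough. *)
pose rho := if z0 == 0 then r - cmod z0 else Num.min (r - cmod z0) (cmod z0).
have [rho0 rho1] : 0 < rho /\ rho <= r - cmod z0.
  rewrite /rho; case: eqVneq => z00.
    by rewrite subr_gt0.
  by rewrite lt_min subr_gt0 z0lt cmod_gt0 z00 ge_min lexx.
have rho2 : z0 != 0 -> rho <= cmod z0.
  by rewrite /rho; case: eqVneq => // _ _; rewrite ge_min lexx orbT.
have rhoC : cmod (rho%:C%C : C) = rho by rewrite cmod_real gtr0_norm.
have inD (w : C) : cmod w <= 1 -> cmod (z0 + rho%:C%C * w) <= r.
  move=> w1; apply: (le_trans (cmodD _ _)); rewrite cmodM rhoC.
  have : rho * cmod w <= rho * 1 by rewrite ler_wpM2l// ltW.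
  lra.
(* The linear term has as real part the cross term of [e * |z0 + rho w|^2], so [F] at [z0 + rho w]
   is [Re (p w)] plus [e * |z0|^2 + e * rho^2 * |w|^2]. A point with [Re (p w) = Re (p 0)] and
   [|w| = 1/2] thus exceeds the maximum. *)
pose p (w : C) : C := q (z0 + rho%:C%C * w) + 2%:C%C * e%:C%C * (z0^*)%C * rho%:C%C * w.
have hp0 : {for 0, continuous p}.
  apply: (@continuousD _ C C (fun w : C => q (z0 + rho%:C%C * w) : C)
     (fun w : C => 2%:C%C * e%:C%C * (z0^*)%C * rho%:C%C * w : C)).
    apply: continuous_comp_affine; apply: punctured_holomorphic_continuous => //.
    by rewrite mulr0 addr0; lra.
  exact/derivable_continuous_at/derivable_lin.
have hp (w : C) : w != 0 -> cmod w < 1 -> derivable p w 1.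
  move=> w0 w1.
  apply: (@derivableD _ C C (fun w : C => q (z0 + rho%:C%C * w) : C)
     (fun w : C => 2%:C%C * e%:C%C * (z0^*)%C * rho%:C%C * w : C)); last exact: derivable_lin.
  apply: derivable_comp_affine; apply: hq.2.
    have [z00|z00] := eqVneq z0 0.
      by rewrite z00 add0r -cmod_gt0 cmodM rhoC mulr_gt0// cmod_gt0.
    apply: contraTneq w1 => /eqP; rewrite addr_eq0 => /eqP zE; rewrite -leNgt.
    have := rho2 z00; rewrite zE cmodN cmodM rhoC.
    by rewrite -{1}(mulr1 rho) ler_pM2l.
  by apply: le_lt_trans r1; apply/inD/ltW.
have h2 : 0 < (2^-1 : R) < 1 by lra.
have [w w2 pE] := mean_value_attained hp0 hp h2.
have w1 : cmod w <= 1 by lra.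
have := z0max _ (inD w w1); rewrite /F sqr_cmodD cmodM rhoC w2.
move: pE; rewrite /p mulr0 addr0 mulr0 addr0 ReD.
have -> : ReC (2%:C%C * e%:C%C * (z0^*)%C * rho%:C%C * w) =
    2 * e * ReC ((z0^*)%C * (rho%:C%C * w)).
  by case: (z0) => a b; case: (w) => c d /=; ring.
have : 0 < e * rho ^+ 2 by rewrite mulr_gt0// exprn_gt0.
set X := ReC (q (z0 + _)); set Y := ReC (_ * _); move=> s1 s2.
have -> : (rho * 2^-1) ^+ 2 = rho ^+ 2 / 4 by rewrite exprMn; congr (_ * _); field.
lra.
Qed.

(** The passage [r -> 1], with [1 - r = s] chosen so that the loss [|x| * 2 * s] is at most [e]. *)
Lemma le_of_scaled_le (a x y : R) : a < 1 ->
  (forall r : R, a < r < 1 -> x * r ^+ 2 <= y) -> x <= y.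
Proof.
move=> a1 xy; apply/ler_addgt0Pr => e e0.
have x1 : 0 < `|x| + 1 by rewrite ltr_pwDr.
pose s := Num.min (Num.min (1 - a) 1) (e / (`|x| + 1)) / 2.
have m0 : 0 < Num.min (Num.min (1 - a) 1) (e / (`|x| + 1)).
  by rewrite !lt_min subr_gt0 a1 ltr01 divr_gt0.
have [s0 s1 s2 s3] : [/\ 0 < s, s < 1 - a, s < 1 & 2 * s <= e / (`|x| + 1)].
  have : Num.min (Num.min (1 - a) 1) (e / (`|x| + 1)) <= 1 - a by rewrite !ge_min lexx.
  have : Num.min (Num.min (1 - a) 1) (e / (`|x| + 1)) <= 1 by rewrite !ge_min lexx orbT.
  have : Num.min (Num.min (1 - a) 1) (e / (`|x| + 1)) <= e / (`|x| + 1).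
    by rewrite !ge_min lexx orbT.
  by rewrite /s; split; lra.
have rI : a < 1 - s < 1 by lra.
have := xy _ rI.
have k1 : x * (1 - (1 - s) ^+ 2) <= `|x| * (2 * s).
  apply: (@le_trans _ _ (`|x| * (1 - (1 - s) ^+ 2))).
    apply: ler_wpM2r; last exact: ler_norm.
    have : s * s <= s * 1 by rewrite ler_wpM2l// ltW.
    lra.
  by rewrite ler_wpM2l//; have := sqr_ge0 s; lra.
have k2 : (`|x| + 1) * (2 * s) <= e by rewrite mulrC -ler_pdivlMr.
lra.
Qed.

(** * Schwarz's lemma for the quotient, with its equality case *)

Section Schwarz.
Variable q : C -> C.
Hypothesis hq : punctured_holomorphic q.
Hypothesis q_bound : forall z : C, z != 0 -> cmod z < 1 -> cmod (q z) * cmod z <= 1.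

(** Multiplying [q] by the constant conjugate of [q z] makes its real part at [z] equal to
    [|q z|^2], so the maximum principle for real parts controls the modulus. *)
Lemma schwarz_bound z : cmod z < 1 -> cmod (q z) <= 1.
Proof.
move=> z1; apply: (le_of_scaled_le z1) => r /andP[zr r1].
have r0 : 0 < r by exact: le_lt_trans (cmod_ge0 z) zr.
have [->|qz0] := eqVneq (q z) 0; first by rewrite cmod0 mul0r.
have qz : 0 < cmod (q z) by rewrite cmod_gt0.
suff : cmod (q z) * r <= 1.
  apply: le_trans; apply: ler_wpM2l; first exact: ltW.
  by rewrite expr2; apply: ler_piMr; exact: ltW.
have hp := punctured_holomorphic_scale ((q z)^*)%C hq.
have : ReC (((q z)^*)%C * q z) <= cmod (q z) / r.
  apply: (maximum_principle_Re hp (r := r)); [by rewrite r0|move=> w wr|exact: ltW].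
  apply: (le_trans (ler_norm _)); apply: (le_trans (Re_le_cmod _)).
  rewrite cmodM cmodJ; apply: ler_wpM2l; first exact: ltW.
  rewrite -[r^-1]mul1r ler_pdivlMr//.
  by rewrite -{1}wr; apply: q_bound; rewrite -?cmod_gt0 wr.
rewrite mulrC mulcJ/= expr2 ler_pM2l//.
by rewrite -[r^-1]mul1r ler_pdivlMr.
Qed.

(** The rotation [b] sends [- |z|] to [z], and the factor [c] normalises the central value to [1],
    the largest possible real part. Rigidity gives real part [1] at [z], and modulus at most [1]
    leaves no imaginary part. *)
Lemma schwarz_rigidity : cmod (q 0) = 1 -> forall z, cmod z < 1 -> q z = q 0.
Proof.
move=> q01 z z1; have [->//|z0] := eqVneq z 0.
have zp : 0 < cmod z by rewrite cmod_gt0.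
set c := ((q 0)^*)%C.
have cq0 : c * q 0 = 1 by rewrite mulrC mulcJ q01 expr1n.
pose b := - (z / (cmod z)%:C%C).
have b1 : cmod b = 1.
  by rewrite cmodN cmodM cmodV cmod_real ger0_norm ?cmod_ge0// divff ?gt_eqF.
have b0 : b != 0 by rewrite -cmod_gt0 b1.
pose p (w : C) : C := c * q (0 + b * w).
have hp0 : {for 0, continuous p}.
  apply: continuous_scale; apply: continuous_comp_affine.
  by rewrite mulr0 addr0; exact: hq.1.
have hp (w : C) : w != 0 -> cmod w < 1 -> derivable p w 1.
  move=> w0 w1; apply: derivable_scale; apply: derivable_comp_affine.
  by rewrite add0r; apply: hq.2; [exact: mulf_neq0|rewrite cmodM b1 mul1r].
have zI : 0 < cmod z < 1 by rewrite zp.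
have := mean_value_rigidity hp0 hp zI.
have p0 : p 0 = 1 by rewrite /p mulr0 addr0.
have cb (w : C) : cmod w < 1 -> cmod (c * q w) <= 1.
  by move=> w1; rewrite cmodM cmodJ q01 mul1r schwarz_bound.
have -> : p (- (cmod z)%:C%C) = c * q z.
  rewrite /p add0r /b mulrNN divfK//.
  by rewrite -cmod_eq0 cmod_real normr_eq0 gt_eqF.
rewrite p0 => /(_ _) Re1.
have {}Re1 : ReC (c * q z) = 1.
  apply: Re1 => w wz; apply: (le_trans (ler_norm _)); apply: (le_trans (Re_le_cmod _)).
  by apply: cb; rewrite add0r cmodM b1 mul1r wz.
have cqz : c * q z = 1.
  have : cmod (c * q z) ^+ 2 <= 1 by rewrite expr_le1// ?cmod_ge0// cb.
  rewrite sqr_cmod; case: (c * q z) Re1 => x y /= ->.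
  rewrite expr1n gerDl => y0.
  have /eqP : y ^+ 2 = 0 by apply/eqP; rewrite eq_le y0 sqr_ge0.
  by rewrite sqrf_eq0 => /eqP ->.
have c0 : c != 0 by apply: contra_eq_neq cq0 => ->; rewrite mul0r eq_sym oner_neq0.
by apply: (mulfI c0); rewrite cqz cq0.
Qed.
End Schwarz.
End MaximumPrinciple.

(** * Functions with real derivative *)

Section RealDerivative.
Variable R : realType.
Local Notation C := (Cplx R).
Local Notation ReC := (@complex.Re R).
Local Notation ImC := (@complex.Im R).

Lemma is_derive_of_expansion (f : R -> R) (x a : R) :
  (forall e : R, 0 < e -> exists2 d : R, 0 < d & forall h : R, `|h| < d ->
    `|f (x + h) - f x - a * h| <= e * `|h|) -> is_derive x 1 f a.
Proof.
move=> fa.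
have lima : h^-1 *: (f (h *: 1 + x) - f x) @[h --> (0 : R)^'] --> a.
  apply/cvgrPdist_le => e e0; have [d d0 dP] := fa e e0.
  apply/nbhs_ballP; exists d => //= h; rewrite -ball_normE/= sub0r normrN => hd h0.
  have hp : 0 < `|h| by rewrite normr_gt0.
  rewrite -(ler_pM2r hp) distrC -normrM -[h *: 1]/(h * 1) mulr1.
  rewrite -[_ *: _]/(h^-1 * (f (h + x) - f x)).
  rewrite mulrBl mulrAC mulVf// mul1r addrC [h + x]addrC addrC; exact: dP.
by split; [apply/cvg_ex; exists a|apply: cvg_lim].
Qed.

(** The constant [k] selects a component: [1] for the real part, [-i] for the imaginary part. *)
Lemma Re_line_is_derive (F : C -> C) (k z0 v : C) (t : R) :
  derivable F (z0 + t%:C%C * v) 1 ->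
  is_derive t 1 (fun s : R => ReC (k * F (z0 + s%:C%C * v)))
    (ReC (k * 'D_1 F (z0 + t%:C%C * v) * v)).
Proof.
set z := z0 + _ => dF; apply: is_derive_of_expansion => e e0.
have kv : 0 < cmod k * cmod v + 1 by rewrite ltr_pwDr// mulr_ge0// cmod_ge0.
have [d d0 dP] := derivable_expansion dF (divr_gt0 e0 kv).
have v1 : 0 < cmod v + 1 by rewrite ltr_pwDr// cmod_ge0.
exists (d / (cmod v + 1)); first exact: divr_gt0.
move=> h; rewrite ltr_pdivlMr// => hd.
have hv : cmod (h%:C%C * v) = `|h| * cmod v by rewrite cmodM cmod_real.
have hvd : cmod (h%:C%C * v) < d.
  by rewrite hv; apply: le_lt_trans hd; rewrite ler_wpM2l// lerDl.
have := dP _ hvd; rewrite hv => k1.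
have -> : z0 + (t + h)%:C%C * v = z + h%:C%C * v by rewrite /z rmorphD/=; ring.
have -> : ReC (k * F (z + h%:C%C * v)) - ReC (k * F z) - ReC (k * 'D_1 F z * v) * h =
    ReC (k * (F (z + h%:C%C * v) - F z - 'D_1 F z * (h%:C%C * v))).
  have -> : ReC (k * 'D_1 F z * v) * h = ReC (k * 'D_1 F z * v * h%:C%C).
    by case: (k * _ * v) => x y /=; ring.
  by rewrite -!ReB; congr ReC; ring.
apply: (le_trans (Re_le_cmod _)); rewrite cmodM.
apply: (le_trans (ler_wpM2l (cmod_ge0 _) k1)).
have -> : cmod k * (e / (cmod k * cmod v + 1) * (`|h| * cmod v)) =
   (e * `|h|) * (cmod k * cmod v / (cmod k * cmod v + 1)) by ring.
apply: ler_piMr; first by rewrite mulr_ge0// ltW.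
by rewrite ler_pdivrMr// mul1r lerDl.
Qed.

Lemma Re_segment_const (F : C -> C) (k z0 v : C) :
  (forall t : R, 0 <= t <= 1 -> derivable F (z0 + t%:C%C * v) 1 /\
     ReC (k * 'D_1 F (z0 + t%:C%C * v) * v) = 0) ->
  ReC (k * F (z0 + v)) = ReC (k * F z0).
Proof.
move=> hF.
have dF (t : R) : 0 <= t <= 1 -> is_derive t 1 (fun s : R => ReC (k * F (z0 + s%:C%C * v))) 0.
  move=> tI; have [d1 <-] := hF t tI; exact: Re_line_is_derive.
have [||t _] := @MVT R (fun s : R => ReC (k * F (z0 + s%:C%C * v))) (fun=> 0) 0 1 ltr01.
- by move=> t; rewrite in_itv/= => /andP[? ?]; apply: dF; lra.
- apply: derivable_within_continuous => t; rewrite in_itv/= => tI.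
  by have [] := dF t tI.
by rewrite mul0r mul1r mul0r addr0 => /eqP; rewrite subr_eq0 => /eqP.
Qed.

Lemma increments_close (a1 a2 x1 y1 x2 y2 t e : R) :
  `|x1 - y1 - a1 * t| <= e / 2 * t -> `|x2 - y2 - a2 * t| <= e / 2 * t ->
  x1 - y1 = x2 - y2 -> `|a1 * t - a2 * t| <= e * t.
Proof.
rewrite !ler_norml => /andP[? ?] /andP[? ?] ?; apply/andP; split; lra.
Qed.

(** Both directional derivatives exist, so agreement of increments for small positive [t] alone
    determines them. *)
Lemma Re_derive_eq (F : C -> C) (k z1 z2 v : C) (d0 : R) : 0 < d0 ->
  derivable F z1 1 -> derivable F z2 1 ->
  (forall t : R, 0 < t < d0 -> ReC (k * (F (z1 + t%:C%C * v) - F z1)) =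
     ReC (k * (F (z2 + t%:C%C * v) - F z2))) ->
  ReC (k * 'D_1 F z1 * v) = ReC (k * 'D_1 F z2 * v).
Proof.
move=> d00 dF1 dF2 E.
have D (z : C) : derivable F z 1 -> is_derive (0 : R) 1 (fun s : R => ReC (k * F (z + s%:C%C * v)))
    (ReC (k * 'D_1 F z * v)).
  move=> dF; have := @Re_line_is_derive F k z v 0; rewrite mul0r addr0; exact.
apply/eqP; rewrite -subr_eq0 -normr_le0; apply/ler_addgt0Pr => e e0; rewrite add0r.
have e2 : 0 < e / 2 by lra.
have [d1 d10 P1] := is_derive_expansion (D z1 dF1) e2.
have [d2 d20 P2] := is_derive_expansion (D z2 dF2) e2.
pose t := Num.min (Num.min d1 d2) d0 / 2.
have m0 : 0 < Num.min (Num.min d1 d2) d0 by rewrite !lt_min d10 d20 d00.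
have m1 : Num.min (Num.min d1 d2) d0 <= d1 by rewrite !ge_min lexx.
have m2 : Num.min (Num.min d1 d2) d0 <= d2 by rewrite !ge_min lexx orbT.
have m3 : Num.min (Num.min d1 d2) d0 <= d0 by rewrite !ge_min lexx orbT.
have [t0 t1 t2 t3] : [/\ 0 < t, t < d1, t < d2 & t < d0] by rewrite /t; split; lra.
have tn : `|t| = t by rewrite gtr0_norm.
have := P1 t; have := P2 t; rewrite tn => /(_ t2) k2 /(_ t1) k1.
have := E t; rewrite t0 t3 => /(_ isT); rewrite !mulrBr !ReB => Et.
rewrite !add0r mul0r !addr0 in k1 k2.
rewrite -(ler_pM2r t0) -{1}tn -normrM mulrBl.
by apply: increments_close k1 k2 Et.
Qed.

Lemma cmod_mono (x y x1 y1 : R) : `|x1| <= `|x| -> `|y1| <= `|y| ->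
  cmod ((x1 +i* y1)%C : C) <= cmod ((x +i* y)%C : C).
Proof.
move=> hx hy; rewrite !cmodE/= ler_sqrt; last by rewrite addr_ge0 ?sqr_ge0.
have sq (a b : R) : `|a| <= `|b| -> a ^+ 2 <= b ^+ 2.
  move=> ab; rewrite -(@real_normK _ a) ?num_real// -(@real_normK _ b) ?num_real//.
  by rewrite ler_pXn2r// nnegrE.
by apply: lerD; exact: sq.
Qed.

(** No derivative of ['D_1 H] is taken. Comparing increments of [H] along parallel segments makes
    ['D_1 H] vanish on both axes; [H] is then constant on each axis, and its two parts elsewhere are
    read off there. *)
Lemma real_derivative_const (H : C -> C) :
  (forall z : C, cmod z < 1 -> derivable H z 1) ->
  (forall z : C, cmod z < 1 -> ImC ('D_1 H z) = 0) -> 'D_1 H 0 = 0 ->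
  forall z : C, cmod z < 1 -> H z = H 0.
Proof.
move=> dH rH H0.
have i1 (w : C) : ReC ((0 -i* 1)%C * w) = ImC w by case: w => a b /=; ring.
have D0 : cmod (0 : C) < 1 by rewrite cmod0.
(* [H'] being real, [Re H] depends only on [x] and [Im H] only on [y]. *)
have vert (x y : R) : cmod ((x +i* y)%C : C) < 1 ->
    ReC (H (x +i* y)%C) = ReC (H (x%:C)%C).
  move=> xy1; have := @Re_segment_const H 1 (x%:C)%C (0 +i* y)%C.
  rewrite !mul1r.
  have -> : (x%:C + (0 +i* y))%C = (x +i* y)%C :> C.
    by apply/eqP; rewrite eq_complex/= addr0 add0r !eqxx.
  apply=> t tI.
  have -> : (x%:C + t%:C * (0 +i* y))%C = (x +i* (t * y))%C :> C.
    by apply/eqP; rewrite eq_complex/=; apply/andP; split; apply/eqP; ring.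
  have wd : cmod ((x +i* (t * y))%C : C) < 1.
    apply: le_lt_trans xy1; apply: cmod_mono => //.
    rewrite normrM ler_piMl// ger0_norm; lra.
  split; first exact: dH.
  have := rH _ wd; rewrite mul1r; case: ('D_1 H _) => a b /= ->; ring.
have horz (x y : R) : cmod ((x +i* y)%C : C) < 1 ->
    ImC (H (x +i* y)%C) = ImC (H (0 +i* y)%C).
  move=> xy1; have := @Re_segment_const H (0 -i* 1)%C (0 +i* y)%C (x%:C)%C.
  rewrite !i1.
  have -> : ((0 +i* y) + x%:C)%C = (x +i* y)%C :> C.
    by apply/eqP; rewrite eq_complex/= addr0 add0r !eqxx.
  apply=> t tI.
  have -> : ((0 +i* y) + t%:C * x%:C)%C = ((t * x) +i* y)%C :> C.
    by apply/eqP; rewrite eq_complex/=; apply/andP; split; apply/eqP; ring.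
  have wd : cmod (((t * x) +i* y)%C : C) < 1.
    apply: le_lt_trans xy1; apply: cmod_mono => //.
    rewrite normrM ler_piMl// ger0_norm; lra.
  split; first exact: dH.
  have := rH _ wd; rewrite -mulrA i1; case: ('D_1 H _) => a b /= ->; ring.
have small (z : C) : cmod z < 1 -> forall v : C, cmod v = 1 -> forall t : R, 0 < t < 1 - cmod z ->
    cmod (z + t%:C%C * v) < 1.
  move=> z1 v v1 t tI; apply: (le_lt_trans (cmodD _ _)).
  rewrite cmodM cmod_real v1 mulr1 gtr0_norm; lra.
(* With [k = -i] and [v = i] the compared quantity is [Re H']; the increments of [Im H] in the
   direction [i] do not depend on [x]. *)
have realD (x : R) : cmod (x%:C%C : C) < 1 -> 'D_1 H (x%:C)%C = 0.
  move=> x1; have dx : 0 < 1 - cmod (x%:C%C : C) by lra.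
  have := @Re_derive_eq H (0 -i* 1)%C (x%:C)%C 0 (0 +i* 1)%C _ dx (dH _ x1) (dH _ D0).
  rewrite H0 mulr0 mul0r => E.
  have := rH _ x1; have : ReC ((0 -i* 1)%C * 'D_1 H (x%:C)%C * (0 +i* 1)%C) = ReC (0 : C).
    apply: E => t tI; rewrite !i1 !ImB.
    have v1 : cmod ((0 +i* 1)%C : C) = 1 by rewrite cmodE/= expr0n expr1n add0r sqrtr1.
    have xt := small _ x1 _ v1 t tI.
    have e1 : (x%:C + t%:C * (0 +i* 1))%C = (x +i* t)%C :> C.
      by apply/eqP; rewrite eq_complex/=; apply/andP; split; apply/eqP; ring.
    have e2 : (0 + t%:C * (0 +i* 1))%C = (0 +i* t)%C :> C.
      by apply/eqP; rewrite eq_complex/=; apply/andP; split; apply/eqP; ring.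
    by rewrite e1 in xt *; rewrite e2 (horz x t xt) (horz x 0 x1).
  case: ('D_1 H _) => a b /= k1 k2; apply/eqP; rewrite eq_complex/=.
  by apply/andP; split; apply/eqP; lra.
(* Here [k = v = 1]: the horizontal increments of [Re H] do not depend on [y]. *)
have imagD (y : R) : cmod ((0 +i* y)%C : C) < 1 -> 'D_1 H (0 +i* y)%C = 0.
  move=> y1; have dy : 0 < 1 - cmod ((0 +i* y)%C : C) by lra.
  have := @Re_derive_eq H 1 (0 +i* y)%C 0 1 _ dy (dH _ y1) (dH _ D0).
  rewrite H0 mulr0 mul0r => E.
  have := rH _ y1; have : ReC (1 * 'D_1 H (0 +i* y)%C * 1) = ReC (0 : C).
    apply: E => t tI; rewrite !mul1r !ReB !mulr1.
    have yt := small _ y1 _ (@cmod1 R) t tI; rewrite mulr1 in yt.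
    have e1 : ((0 +i* y) + t%:C)%C = (t +i* y)%C :> C.
      by apply/eqP; rewrite eq_complex/= addr0 add0r !eqxx.
    by rewrite e1 in yt *; rewrite add0r (vert t y yt) (vert 0 y y1).
  rewrite mul1r mulr1.
  case: ('D_1 H _) => a b /= k1 k2; apply/eqP; rewrite eq_complex/=.
  by apply/andP; split; apply/eqP; lra.
move=> [x y] z1.
have x1 : cmod (x%:C%C : C) < 1.
  by apply: le_lt_trans z1; apply: cmod_mono => //; rewrite normr0.
have y1 : cmod ((0 +i* y)%C : C) < 1.
  by apply: le_lt_trans z1; apply: cmod_mono => //; rewrite normr0.
have hx : ReC (H (x%:C)%C) = ReC (H 0).
  have := @Re_segment_const H 1 0 (x%:C)%C; rewrite add0r !mul1r; apply=> t tI.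
  have -> : (0 + t%:C * x%:C)%C = ((t * x)%:C)%C :> C by rewrite add0r rmorphM.
  have wd : cmod ((t * x)%:C%C : C) < 1.
    by apply: le_lt_trans x1; apply: cmod_mono => //; rewrite normrM ler_piMl// ger0_norm; lra.
  by split; [exact: dH|rewrite realD// mulr0 mul0r].
have hy : ImC (H (0 +i* y)%C) = ImC (H 0).
  have := @Re_segment_const H (0 -i* 1)%C 0 (0 +i* y)%C; rewrite add0r !i1; apply=> t tI.
  have -> : (0 + t%:C * (0 +i* y))%C = (0 +i* (t * y))%C :> C.
    by apply/eqP; rewrite eq_complex/=; apply/andP; split; apply/eqP; ring.
  have wd : cmod ((0 +i* (t * y))%C : C) < 1.
    by apply: le_lt_trans y1; apply: cmod_mono => //; rewrite normrM ler_piMl// ger0_norm; lra.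
  by split; [exact: dH|rewrite imagD// mulr0 mul0r].
apply/eqP; rewrite eq_complex; apply/andP; split; apply/eqP.
  by rewrite vert.
by rewrite horz.
Qed.
End RealDerivative.

(** * The diameter version of Schwarz's lemma *)

Section LandauToeplitz.
Variable R : realType.
Local Notation C := (Cplx R).
Local Notation ReC := (@complex.Re R).
Local Notation ImC := (@complex.Im R).

Definition rotation_diff (F : C -> C) (w z : C) : C := F z - F (w * z).

Lemma derivable_rotation_diff F w z :
  (forall z : C, cmod z < 1 -> derivable F z 1) -> cmod w = 1 -> cmod z < 1 ->
  derivable (rotation_diff F w) z 1.
Proof.
move=> dF w1 z1.
apply: (@derivableB _ C C F (fun z : C => F (w * z) : C)); first exact: dF.
have -> : (fun z : C => F (w * z)) = (fun z : C => F (0 + w * z)).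
  by apply/funext => x; rewrite add0r.
by apply: derivable_comp_affine; apply: dF; rewrite add0r cmodM w1 mul1r.
Qed.

Lemma punctured_holomorphic_rotation_slope F w :
  (forall z : C, cmod z < 1 -> derivable F z 1) -> cmod w = 1 ->
  punctured_holomorphic (slope0 (rotation_diff F w)).
Proof.
move=> dF w1; split.
  apply: continuous_slope0; last by rewrite /rotation_diff mulr0 subrr.
  by apply: derivable_rotation_diff => //; rewrite cmod0.
by move=> z z0 z1; apply: derivable_slope0 => //; exact: derivable_rotation_diff.
Qed.

Lemma derive_rotation_diff0 F : (forall z : C, cmod z < 1 -> derivable F z 1) ->
  'D_1 (rotation_diff F (-1)) 0 = 2 * 'D_1 F 0.
Proof.
move=> dF; have z1 : cmod (0 : C) < 1 by rewrite cmod0.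
have n1 : cmod (-1 : C) = 1 by rewrite cmodN cmod1.
apply: derive_unique; first exact: derivable_rotation_diff.
move=> e e0; have e2 : 0 < e / 2 by rewrite divr_gt0.
have [d d0 dP] := derivable_expansion (dF 0 z1) e2.
exists d => // h hd; have hd' : cmod (- h) < d by rewrite cmodN.
have := dP _ hd; have := dP _ hd'; rewrite cmodN !add0r => k1 k2.
rewrite /rotation_diff mulr0 mulN1r.
have -> : F h - F (- h) - (F 0 - F 0) - 2 * 'D_1 F 0 * h =
  (F h - F 0 - 'D_1 F 0 * h) - (F (- h) - F 0 - 'D_1 F 0 * (- h)) by ring.
apply: (le_trans (cmodD _ _)); rewrite cmodN [e]splitr mulrDl.
exact: lerD.
Qed.

(* Parametrised so that [1 - circle_point s = 2 s (s - i) / (1 + s^2)]. *)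
Definition circle_point (s : R) : C :=
  (((1 - s ^+ 2) / (1 + s ^+ 2)) +i* ((2 * s) / (1 + s ^+ 2)))%C.

Lemma cmod_circle_point s : cmod (circle_point s) = 1.
Proof.
have s1 : 1 + s ^+ 2 != 0 by rewrite gt_eqF// ltr_pwDl// sqr_ge0.
apply/eqP; rewrite -(@eqrXn2 _ 2) ?cmod_ge0// sqr_cmod expr1n/=.
by apply/eqP; field.
Qed.

(** * The derivative bound under the diameter condition, and the extremal functions *)

Section Extremal.
Variable f : C -> C.
Hypothesis fd : forall z : C, cmod z < 1 -> derivable f z 1.
Hypothesis fdiam : forall z w : C, cmod z < 1 -> cmod w < 1 -> cmod (f z - f w) <= 2.
Local Notation c := ('D_1 f 0).

(** The quotient of the odd part of [f] by [z]; the diameter condition at [z] and [- z] is exactly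
    the hypothesis of Schwarz's lemma. *)
Let q (z : C) : C := 2^-1 * slope0 (rotation_diff f (-1)) z.

Let cmodN1 : cmod (-1 : C) = 1. Proof. by rewrite cmodN cmod1. Qed.

Let cmod2 : cmod (2 : C) = 2.
Proof.
have -> : (2 : C) = (2%:C)%C by rewrite -[2]/(2%:R) rmorph_nat.
by rewrite cmod_real normr_nat.
Qed.

Let q_holo : punctured_holomorphic q.
Proof. exact/punctured_holomorphic_scale/punctured_holomorphic_rotation_slope. Qed.

Let C2 : (2 : C) != 0. Proof. by rewrite -cmod_gt0 cmod2. Qed.

Let q0 : q 0 = c.
Proof. by rewrite /q /slope0 eqxx derive_rotation_diff0// mulrA mulVf// mul1r. Qed.

Let q_bound (z : C) : z != 0 -> cmod z < 1 -> cmod (q z) * cmod z <= 1.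
Proof.
move=> z0 z1; rewrite -cmodM /q /slope0 (negbTE z0) mulrA mulfVK// cmodM cmodV cmod2.
rewrite mulrC ler_pdivrMr// mul1r /rotation_diff; apply: fdiam => //.
by rewrite cmodM cmodN1 mul1r.
Qed.

Lemma derive0_bound : cmod c <= 1.
Proof. by rewrite -q0; apply: schwarz_bound => //; rewrite cmod0. Qed.

Hypothesis c1 : cmod c = 1.

Lemma extremal_odd_part z : cmod z < 1 -> f z - f (- z) = 2 * c * z.
Proof.
move=> z1; have [->|z0] := eqVneq z 0; first by rewrite oppr0 subrr mulr0.
have : q z = c by rewrite -q0; apply: schwarz_rigidity => //; rewrite q0.
rewrite /q /slope0 (negbTE z0) /rotation_diff mulN1r => <-.
by rewrite (mulVKf C2) divfK.
Qed.

Let H (z : C) : C := (c^*)%C * (f z - c * z).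

Let cJc : c * (c^*)%C = 1. Proof. by rewrite mulcJ c1 expr1n. Qed.

Let fE z : f z = c * (z + H z).
Proof. by rewrite /H mulrDr [c * (_ * _)]mulrA cJc mul1r; ring. Qed.

Let dH (z : C) : cmod z < 1 -> derivable H z 1.
Proof.
move=> z1; apply: derivable_scale.
apply: (@derivableB _ C C f (fun z : C => c * z : C)); first exact: fd.
exact: derivable_lin.
Qed.

Let H_even z : cmod z < 1 -> H (- z) = H z.
Proof.
move=> z1; rewrite /H; congr (_ * _).
have := extremal_odd_part z1 => /eqP; rewrite subr_eq => /eqP ->; ring.
Qed.

Let H_derive0 : 'D_1 H 0 = 0.
Proof.
apply: derive_unique; first by apply: dH; rewrite cmod0.
have z1 : cmod (0 : C) < 1 by rewrite cmod0.
move=> e e0; have [d d0 dP] := derivable_expansion (fd z1) e0.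
exists d => // h hd; have := dP h hd; rewrite !add0r mul0r subr0.
have -> : H h - H 0 = (c^*)%C * (f h - f 0 - c * h) by rewrite /H mulr0; ring.
by rewrite cmodM cmodJ c1 mul1r.
Qed.

Let U (w : C) := slope0 (rotation_diff H w).

(** The pair [z], [- (w * z)] gives [|2 z + B| <= 2] with [B = z (U - (1 - w))]. Squaring and
    dropping [|B|^2] leaves [4 r^2 + 4 r^2 (Re U - (1 - Re w)) <= 4] for [r = |z|]. *)
Let U_circle (w z : C) : cmod w = 1 -> z != 0 -> cmod z < 1 ->
  ReC (U w z) <= 1 - ReC w + (1 - cmod z ^+ 2) / cmod z ^+ 2.
Proof.
move=> w1 z0 z1.
have wz1 : cmod (w * z) < 1 by rewrite cmodM w1 mul1r.
have wz1' : cmod (- (w * z)) < 1 by rewrite cmodN.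
have zp : 0 < cmod z ^+ 2 by rewrite exprn_gt0// cmod_gt0.
have := fdiam z1 wz1'; rewrite !fE -mulrBr cmodM c1 mul1r H_even//.
pose D := H z - H (w * z); pose B := D - (1 - w) * z.
have -> : z + H z - (- (w * z) + H (w * z)) = 2 * z + B by rewrite /B /D; ring.
move=> k1.
have : cmod (2 * z + B) ^+ 2 <= 2 ^+ 2.
  by rewrite ler_pXn2r// nnegrE ?cmod_ge0.
rewrite sqr_cmodD cmodM cmod2.
have -> : B = z * (U w z - (1 - w)).
  by rewrite /B /U /slope0 (negbTE z0) /rotation_diff -/D mulrBr mulrCA divff// mulr1; ring.
have -> : ReC (((2 * z)^*)%C * (z * (U w z - (1 - w)))) =
   2 * (cmod z ^+ 2 * (ReC (U w z) - (1 - ReC w))).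
  rewrite sqr_cmod; case: (U w z) => a b; case: (w) => a1 b1; case: (z) => x y /=; ring.
rewrite -lerBlDl ler_pdivlMr//.
have := sqr_ge0 (cmod (z * (U w z - (1 - w)))).
move: (cmod (_ * _) ^+ 2) (cmod z) (ReC (U w z)) (ReC w) => Y m u v.
by move=> *; lra.
Qed.

Let U_bound (w z : C) : cmod w = 1 -> cmod z < 1 -> ReC (U w z) <= 1 - ReC w.
Proof.
move=> w1 z1.
(* Adding [1] absorbs the error [1 / r^2 - 1], so that the bound on the circle reads
   [x * r ^+ 2 <= 1]. *)
suff : ReC (U w z) - (1 - ReC w) + 1 <= 1 by rewrite gerDr subr_le0.
apply: (le_of_scaled_le z1) => r /andP[zr r1].
have r0 : 0 < r by exact: le_lt_trans (cmod_ge0 z) zr.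
have r2 : 0 < r ^+ 2 by rewrite exprn_gt0.
have : ReC (U w z) <= 1 - ReC w + (1 - r ^+ 2) / r ^+ 2.
  apply: (@maximum_principle_Re _ (U w) r); last exact: ltW.
  - exact: punctured_holomorphic_rotation_slope.
  - by rewrite r0.
  - move=> x xr; have := @U_circle w x w1; rewrite xr; apply => //.
    by rewrite -cmod_gt0 xr.
rewrite -lerBlDl ler_pdivlMr//.
move: (ReC (U w z)) (ReC w) => u v; lra.
Qed.

Let U_abs_bound (w z : C) : cmod w = 1 -> z != 0 -> cmod z < 1 ->
  `|ReC (U w z)| <= 1 - ReC w.
Proof.
move=> w1 z0 z1; rewrite ler_norml U_bound// andbT lerNl.
have z1' : cmod (- z) < 1 by rewrite cmodN.
have := U_bound w1 z1'.
suff -> : U w (- z) = - U w z by rewrite ReN.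
rewrite /U /slope0 oppr_eq0 (negbTE z0) /rotation_diff mulrN !H_even//.
  by rewrite invrN mulrN.
by rewrite cmodM w1 mul1r.
Qed.

(** For [w = circle_point s] the quotient [U w z] is close to [- A (w - 1)], and [Re (A (w - 1))] is
    [2 s / (1 + s^2)] times [- (s Re A + Im A)]. Dividing the bound [1 - Re w = 2 s^2 / (1 + s^2)]
    by that factor leaves [|Im A|] arbitrarily small. *)
Let H_real (z : C) : cmod z < 1 -> ImC ('D_1 H z) = 0.
Proof.
move=> z1; have [->|z0] := eqVneq z 0; first by rewrite H_derive0.
apply/eqP; rewrite -normr_le0; apply/ler_addgt0Pr => e e0; rewrite add0r.
set A := 'D_1 H z.
have e3 : 0 < e / 3 by rewrite divr_gt0.
have [d d0 dP] := derivable_expansion (dH z1) e3.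
pose A1 := `|ReC A| + 1.
have A10 : 0 < A1 by rewrite ltr_pwDr.
(* The condition [4 * s < d] puts [(w - 1) * z] within the range of the expansion; [s <= 1] bounds
   the remainder by [2 * e / 3], and [s * A1 <= e / 3] covers [s + s * |Re A|]. *)
have [s [s0 s1 sd sA]] : exists s : R, [/\ 0 < s, s <= 1, 4 * s < d & s * A1 <= e / 3].
  exists (Num.min (Num.min 1 (d / 5)) (e / 3 / A1)); split.
  - by rewrite !lt_min ltr01 !divr_gt0.
  - by rewrite !ge_min lexx.
  - apply: (@le_lt_trans _ _ (4 * (d / 5))); last by lra.
    by rewrite ler_wpM2l// !ge_min lexx orbT.
  - by rewrite -ler_pdivlMr// ge_min lexx orbT.
set w := circle_point s.
have w1 : cmod w = 1 by exact: cmod_circle_point.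
have ss : 0 < 1 + s ^+ 2 by rewrite ltr_pwDl// sqr_ge0.
have Ew : w - 1 = (((- 2 * s ^+ 2) / (1 + s ^+ 2)) +i* ((2 * s) / (1 + s ^+ 2)))%C.
  apply/eqP; rewrite eq_complex/= oppr0 addr0 eqxx andbT; apply/eqP.
  by field; rewrite gt_eqF.
have nw : cmod (w - 1) <= 2 * s * (s + 1) / (1 + s ^+ 2).
  rewrite Ew; apply: (le_trans (cmod_le_ReIm _)) => /=.
  rewrite !normrM normrN normr_nat normfV (gtr0_norm ss) !gtr0_norm ?exprn_gt0//.
  rewrite -mulrDl ler_pM2r ?invr_gt0//; lra.
have nw4 : cmod (w - 1) <= 4 * s.
  apply: (le_trans nw); rewrite ler_pdivrMr//.
  have : s * s <= s * 1 by rewrite ler_wpM2l// ltW.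
  have : 0 <= s * s ^+ 2 by rewrite mulr_ge0// ?sqr_ge0// ltW.
  lra.
have hd : cmod ((w - 1) * z) < d.
  rewrite cmodM; apply: le_lt_trans sd; apply: le_trans nw4.
  by apply: ler_piMr; [exact: cmod_ge0|exact: ltW].
have := dP _ hd.
have -> : z + (w - 1) * z = w * z by ring.
have zp : 0 < cmod z by rewrite cmod_gt0.
have -> : H (w * z) - H z - 'D_1 H z * ((w - 1) * z) = - (U w z + A * (w - 1)) * z.
  have UE : U w z * z = H z - H (w * z) by rewrite /U /slope0 (negbTE z0) mulfVK.
  have -> : - (U w z + A * (w - 1)) * z = - (U w z * z) - A * (w - 1) * z by ring.
  by rewrite UE /A; ring.
rewrite !cmodM cmodN mulrA ler_pM2r// => k1.
have k2 : `|ReC (A * (w - 1))| <= 1 - ReC w + e / 3 * cmod (w - 1).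
  have -> : ReC (A * (w - 1)) = ReC (U w z + A * (w - 1)) - ReC (U w z).
    by rewrite ReD [X in _ = X]addrC addKr.
  apply: (le_trans (ler_normB _ _)); rewrite addrC; apply: lerD.
    exact: U_abs_bound.
  exact: le_trans (Re_le_cmod _) k1.
have k3 : 1 - ReC w = 2 * s * s / (1 + s ^+ 2) by rewrite /=; field; rewrite gt_eqF.
have k4 : ReC (A * (w - 1)) = - (s * ReC A + ImC A) * (2 * s / (1 + s ^+ 2)).
  by rewrite Ew; case: (A) => a b /=; field; rewrite gt_eqF.
have p0 : 0 < 2 * s / (1 + s ^+ 2) by rewrite divr_gt0// mulr_gt0.
have k5 : `|s * ReC A + ImC A| <= s + e / 3 * (s + 1).
  rewrite -(ler_pM2r p0) -{1}(gtr0_norm p0) -normrM -normrN -mulNr -k4.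
  apply: (le_trans k2); rewrite k3.
  have -> : (s + e / 3 * (s + 1)) * (2 * s / (1 + s ^+ 2)) =
    2 * s * s / (1 + s ^+ 2) + e / 3 * (2 * s * (s + 1) / (1 + s ^+ 2)) by ring.
  by rewrite lerD2l; apply: ler_wpM2l nw; exact: ltW.
have -> : ImC A = (s * ReC A + ImC A) - s * ReC A by rewrite addrC addKr.
apply: (le_trans (ler_normB _ _)).
have k6 : `|s * ReC A| = s * `|ReC A| by rewrite normrM gtr0_norm.
have k7 : s + s * `|ReC A| <= e / 3 by move: sA; rewrite /A1 mulrDr mulr1 addrC.
have k8 : e / 3 * (s + 1) <= e / 3 * 2 by apply: ler_wpM2l; [exact: ltW|lra].
rewrite k6; apply: (le_trans (lerD k5 (lexx _))).
move: k7 k8; move: (s * `|ReC A|) (e / 3 * (s + 1)) => *; lra.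
Qed.

Lemma extremal_affine z : cmod z < 1 -> f z = f 0 + c * z.
Proof.
move=> z1; rewrite [f z]fE (real_derivative_const dH H_real H_derive0 z1).
by rewrite [f 0]fE; ring.
Qed.
End Extremal.
End LandauToeplitz.

Theorem theorem2 (R : realType) (f : Cplx R -> Cplx R) :
  analytic_on_disk f ->
  Diam_le (f @` unit_disk R) 2 ->
  `|'D_1 f 0| <= 1 /\
  (`|'D_1 f 0| = 1 <->
     exists a c : Cplx R, `|c| = 1 /\
       (forall z : Cplx R, z \in unit_disk R -> f z = a + c * z)).
Proof.
move=> fa fD.
have fd (z : Cplx R) : cmod z < 1 -> derivable f z 1.
  by move=> z1; apply: fa; rewrite unit_diskE.
have fdiam (z w : Cplx R) : cmod z < 1 -> cmod w < 1 -> cmod (f z - f w) <= 2.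
  rewrite -!unit_diskE !inE => zD wD.
  have := fD (f z) (f w) (imageP f zD) (imageP f wD).
  by rewrite norm_cmod -[2]/(2%:R) -(rmorph_nat (real_complex R)) lecR.
have norm1 (z : Cplx R) : `|z| = 1 <-> cmod z = 1.
  rewrite norm_cmod; split=> [|->//]; exact: complexI.
have z1 : cmod (0 : Cplx R) < 1 by rewrite cmod0.
split; first by rewrite norm_cmod lecR; exact: derive0_bound.
split=> [/norm1 c1|[a [c [c1 fE]]]].
  exists (f 0), ('D_1 f 0); split; first exact/norm1.
  by move=> z; rewrite unit_diskE; exact: extremal_affine.
suff -> : 'D_1 f 0 = c by [].
apply: derive_unique; first exact: fd.
(* Radius [1] keeps [h] in the disc, where the expansion of the affine function is exact. *)
move=> e e0; exists 1 => // h h1.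
rewrite add0r !fE ?unit_diskE// mulr0 addr0.
have -> : a + c * h - a - c * h = 0 by ring.
by rewrite cmod0 mulr_ge0 ?cmod_ge0// ltW.
Qed.
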